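(* Let $k\subset\mathbb{C}$ be a countable field of characteristic $0$, let $g(s,z)\in k(S)(z)$ be a $k$-algebraic family of rational functions indexed by $S=\mathbb{A}^p$, and let $f(z)\in k(z)$ be a rational function with at least one non-zero residue. Assume that for some $s_0\in S(k)$, the rational function $g(s_0,z)$ is identically equal to $0$. Then for every realization $s\in S(\mathbb{C})$ of the generic type of $S$ over $k$, the generic type of $$y''+y'f(y)+g(s,y)=0$$ is orthogonal to the constants.
   Context: $(\mathcal{U},\delta)$ is a saturated model of $DCF_0$ with field of constants $\mathbb{C}$, $y'=\delta(y)$. Residues of $f$ are at points of $\mathbb{C}$. A $k$-algebraic family of rational functions indexed by $S=\mathbb{A}^p$ is an element $g(s,z)\in k(S)(z)$; the hypothesis on $s_0$ includes that $g(s,z)$ can be specialized at $s_0$, i.e. $g=A/B$ with $A,B\in k[s_1,\ldots,s_p][z]$, $B(s_0,z)\neq0$ (and $A(s_0,z)=0$). A realization of the generic type of $S$ over $k$ is a point $s\in\mathbb{C}^p$ whose coordinates are algebraically independent over $k$. The generic type of the equation is the type over $k(s)$ of a solution $y\in\mathcal{U}$ with $\operatorname{trdeg}_{k(s)}k(s)(y,y')=2$. A complete type $q$ over a differential field $K$ is orthogonal to the constants if for every (small) differential field extension $F\supseteq K$ in $\mathcal{U}$ and every realization $a$ of $q$ such that $K\langle a\rangle$ is algebraically disjoint from $F$ over $K$, every constant of $F\langle a\rangle$ lies in $F^{alg}$. Here $F\langle a\rangle$ is the differential field generated by $a$ over $F$. *)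

(* Defs.v *)
From HB Require Import structures.
From mathcomp Require Export all_boot all_order all_algebra.
From mathcomp Require Export mpoly.
From mathcomp Require Export fraction.
From mathcomp Require Export complex.
From mathcomp Require Export classical_sets functions cardinality reals.

Set Implicit Arguments.
Unset Strict Implicit.
Unset Printing Implicit Defensive.

Import GRing.Theory.
Local Open Scope ring_scope.
Local Open Scope classical_set_scope.

Notation "x %:F" := (FracField.tofrac x) : ring_scope.

(* Closure under [x / y] needs no [y != 0], since [x / 0 = 0]. *)
Definition is_subfield (E : fieldType) (K : set E) : Prop :=
  [/\ K 1, (forall x y, K x -> K y -> K (x - y))
         & (forall x y, K x -> K y -> K (x / y))].

Definition field_gen (E : fieldType) (X : set E) : set E :=
  [set x | forall L : set E, is_subfield L -> X `<=` L -> L x].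

Definition algebraic_over (E : fieldType) (K : set E) (x : E) : Prop :=
  exists P : {poly E}, [/\ P != 0, (forall i, K P`_i) & root P x].

Definition alg_independent (E : fieldType) (K : set E) (n : nat)
    (t : 'I_n -> E) : Prop :=
  forall P : {mpoly E[n]}, (forall m, K P@_m) -> P.@[t] = 0 -> P = 0.

Definition has_trdeg (E : fieldType) (K L : set E) (n : nat) : Prop :=
  exists t : 'I_n -> E,
    [/\ (forall i, L (t i)), alg_independent K t
      & forall x, L x -> algebraic_over (field_gen (K `|` range t)) x].

(* [L] is free from [F] over [K]. *)
Definition alg_disjoint (E : fieldType) (K L F : set E) : Prop :=
  forall (n : nat) (t : 'I_n -> E),
    (forall i, L (t i)) -> alg_independent K t -> alg_independent F t.

Definition is_diff_subfield (U : fieldType) (d : U -> U) (K : set U) : Prop :=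
  is_subfield K /\ (forall x, K x -> K (d x)).

Definition diff_field_gen (U : fieldType) (d : U -> U) (X : set U) : set U :=
  [set x | forall L : set U, is_diff_subfield d L -> X `<=` L -> L x].

(* The last clause is Blum's axiom.  [f] is a differential polynomial of order
   exactly [n] (some monomial involves the last variable, which stands for the
   [n]-th derivative) and [g] a nonzero differential polynomial of order
   [< n]; for [n = 0], [g] is a nonzero constant and the axiom says that [U] is
   algebraically closed. *)
Definition is_DCF0 (U : fieldType) (d : U -> U) : Prop :=
  [/\ [pchar U] =i pred0,
      (forall x y, d (x + y) = d x + d y),
      (forall x y, d (x * y) = d x * y + x * d y)
    & forall (n : nat) (f : {mpoly U[n.+1]}) (g : {mpoly U[n]}),
        (exists2 m, m \in msupp f & m ord_max != 0%N) -> g != 0 ->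
        exists x : U, f.@[fun i => iter i d x] = 0
                   /\ g.@[fun i => iter i d x] != 0].

(* Formulas with parameters in [U] whose free variables are indexed by [V]; a
   quantifier binds the variable [None] of [option V]. *)
Inductive dterm (U V : Type) : Type :=
| DVar of V
| DParam of U
| DZero
| DOne
| DAdd of dterm U V & dterm U V
| DOpp of dterm U V
| DMul of dterm U V & dterm U V
| DDer of dterm U V.

Inductive dformula (U V : Type) : Type :=
| DEq of dterm U V & dterm U V
| DNot of dformula U V
| DAnd of dformula U V & dformula U V
| DExists of dformula U (option V).

Fixpoint dterm_over (U V : Type) (A : set U) (t : dterm U V) : Prop :=
  match t with
  | DVar _ | DZero | DOne => True
  | DParam c => A c
  | DAdd t1 t2 | DMul t1 t2 => dterm_over A t1 /\ dterm_over A t2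
  | DOpp t1 | DDer t1 => dterm_over A t1
  end.

Fixpoint dformula_over (U V : Type) (A : set U) (phi : dformula U V) : Prop :=
  match phi with
  | DEq t1 t2 => dterm_over A t1 /\ dterm_over A t2
  | DNot psi => dformula_over A psi
  | DAnd psi1 psi2 => dformula_over A psi1 /\ dformula_over A psi2
  | DExists psi => dformula_over A psi
  end.

Fixpoint deval (U : fieldType) (d : U -> U) (V : Type) (e : V -> U)
    (t : dterm U V) : U :=
  match t with
  | DVar v => e v
  | DParam c => c
  | DZero => 0
  | DOne => 1
  | DAdd t1 t2 => deval d e t1 + deval d e t2
  | DOpp t1 => - deval d e t1
  | DMul t1 t2 => deval d e t1 * deval d e t2
  | DDer t1 => d (deval d e t1)
  end.

Fixpoint dholds (U : fieldType) (d : U -> U) (V : Type)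
    (phi : dformula U V) : (V -> U) -> Prop :=
  match phi with
  | DEq t1 t2 => fun e => deval d e t1 = deval d e t2
  | DNot psi => fun e => ~ dholds d psi e
  | DAnd psi1 psi2 => fun e => dholds d psi1 e /\ dholds d psi2 e
  | DExists psi => fun e => exists x : U, dholds d psi (oapp e x)
  end.

(* A 1-type is a set of formulas in the single free variable [tt : unit]. *)
Definition realizes (U : fieldType) (d : U -> U) (q : set (dformula U unit))
    (a : U) : Prop :=
  forall phi, q phi -> dholds d phi (fun _ => a).

Definition tp (U : fieldType) (d : U -> U) (K : set U) (a : U) :
    set (dformula U unit) :=
  [set phi | dformula_over K phi /\ dholds d phi (fun _ => a)].

Definition small (U : Type) (A : set U) : Prop := ~ ([set: U] #<= A)%card.

Definition saturated (U : fieldType) (d : U -> U) : Prop :=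
  forall (A : set U) (q : set (dformula U unit)),
    small A -> (forall phi, q phi -> dformula_over A phi) ->
    (forall q0, finite_set q0 -> q0 `<=` q -> exists a, realizes d q0 a) ->
    exists a, realizes d q a.

(* [q] is meant to be a complete type over the differential subfield [K]. *)
Definition orthogonal_to_constants (U : fieldType) (d : U -> U) (K : set U)
    (q : set (dformula U unit)) : Prop :=
  forall F : set U, is_diff_subfield d F -> K `<=` F -> small F ->
  forall a : U, realizes d q a ->
    alg_disjoint K (diff_field_gen d (K `|` [set a])) F ->
  forall c : U, diff_field_gen d (F `|` [set a]) c -> d c = 0 ->
    algebraic_over F c.

Definition generic_solution (U : fieldType) (d : U -> U) (K : set U)
    (f g : U -> U) (y : U) : Prop :=
  d (d y) + d y * f y + g y = 0
  /\ has_trdeg K (field_gen (K `|` [set y; d y])) 2.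

Definition is_generic_type (U : fieldType) (d : U -> U) (K : set U)
    (f g : U -> U) (q : set (dformula U unit)) : Prop :=
  exists2 y, generic_solution d K f g y & q = tp d K y.

(* [mmap h s] sends the coefficients along [h] and the variables to [s]. *)
Definition specialize (k E : fieldType) (h : {rmorphism k -> E}) (p : nat)
    (s : 'I_p -> E) (A : {poly {mpoly k[p]}}) : {poly E} :=
  map_poly (mmap h s) A.

(* The principal part of [f] at [c] is
   [a`_0 / (z - c) + a`_1 / (z - c)^2 + ...], i.e., [f] minus this sum is
   regular at [c]; the residue is [a`_0]. *)
Definition has_residue (C : fieldType) (f : {fraction {poly C}}) (c r : C) :
    Prop :=
  exists a u v : {poly C},
    [/\ v.[c] != 0,
        f = \sum_(i < size a) (a`_i)%:P%:F / (('X - c%:P) ^+ i.+1)%:F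
            + u%:F / v%:F
      & r = a`_0].

(* Main.v *)
From HB Require Import structures.
Require Import Defs.
From mathcomp Require Import boolp fingroup perm.
From mathcomp Require Import ring.

(** Orthogonality says that a constant of [F(a, a')], where [a] is a generic
    solution over a differential field [F], is algebraic over [F]; it is shown
    to lie in [F]. There are three steps.

    The limit equation [y'' = - f(y) y'], which is the equation at [s0]. Let
    [x] be a solution with [x, x'] independent over [F]. The numerator and the
    denominator of a constant of [F(x, x')], as polynomials in [x'] over [F(x)],
    divide their own derivatives. Let [q] be such a polynomial, monic of degree
    [n] and with a nonzero value [q_0] at [x' = 0]. Comparing the coefficients
    of [q'] and [q] in degrees [n] and [0] gives [D2 q_0 / q_0 = D1 q_(n-1) - n f],
    where [D1] differentiates with respect to [x] and [D2] differentiates the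
    coefficients. At the pole [c] of [f] with nonzero residue, a constant, the
    left side is regular and [D1 q_(n-1)] has no residue; so [n = 0]. Only the
    powers of [x'] are left, and they are excluded in the same way
    ([limit_equation_constants]). Adding solutions one at a time, a field
    generated over constants by independent solutions of the limit equation has
    no new constants ([limit_field_constants]).

    Degeneration. Several copies of the equation define a vector field whose
    coefficients are polynomials in [s]. Restricted to the line through [s0] and
    [s], with parameter [t], it has a member [t = 0] with trivial constants, and
    successive reductions modulo [t] of a constant fraction show that the
    constants of the whole family are trivial ([constants_degeneration]). A
    constant of the field [L] generated over [K = k(s)] by independent solutions
    for the parameter [s] is a fraction whose constancy is an identity over
    [k[S]], because [s] is generic; hence it lies in [K]
    ([generic_field_constants]).

    Arbitrary [F]. The first step works over any differential field, but the
    degeneration does not, since nothing is known of the derivation of [F] near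
    [s0]. The elements of [F] are therefore eliminated. A constant of [F(a, a')]
    is the value at [a] of a fraction [G / H] over [F]. Saturation provides
    solutions [z_j], each generic over [F] and the previous ones, and the values
    [c_j] of [G / H] at [z_j] are constants too. The equations
    [G(z_j) = c_j H(z_j)] are linear in the coefficients of [G] and [H], with
    entries in [C(z)], where [C] is the field of all constants; with enough
    solutions the determinant vanishes. As the constants of [L] lie in [K], the
    field [L] is linearly disjoint from [C] over [K], and the [z_j] remain
    independent over [C] ([independent_over_constants]). So the determinant
    vanishes identically in the [z_j]. At well chosen points this is false if
    the [c_j] are distinct ([constant_values_dependent]), and they are distinct
    unless [G / H] is a scalar, that is, unless the constant lies in [F]
    ([generic_solution_constants]). *)

Set Implicit Arguments.
Unset Strict Implicit.
Unset Printing Implicit Defensive.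

Import GRing.Theory.
Local Open Scope ring_scope.
Local Open Scope classical_set_scope.

(** * Derivations *)

Definition is_derivation (A : comNzRingType) (D : A -> A) : Prop :=
  {morph D : x y / x + y} /\ (forall x y, D (x * y) = D x * y + x * D y).

Section DerivationRing.
Variables (A : comNzRingType) (D : A -> A) (derD : is_derivation D).

Lemma derivationD : {morph D : x y / x + y}. Proof. exact: derD.1. Qed.

Lemma derivationM x y : D (x * y) = D x * y + x * D y.
Proof. exact: derD.2. Qed.

Lemma derivation0 : D 0 = 0.
Proof. by apply: (addrI (D 0)); rewrite -derivationD !addr0. Qed.

Lemma derivation1 : D 1 = 0.
Proof.
by apply: (addrI (D 1)); rewrite -{3}[1]mulr1 derivationM mulr1 mul1r addr0.
Qed.

Lemma derivationN : {morph D : x / - x}.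
Proof. by move=> x; apply: (addrI (D x)); rewrite -derivationD !subrr derivation0. Qed.

Lemma derivationB : {morph D : x y / x - y}.
Proof. by move=> x y; rewrite derivationD derivationN. Qed.

Lemma derivation_sum (I : Type) (r : seq I) (P : pred I) (F : I -> A) :
  D (\sum_(i <- r | P i) F i) = \sum_(i <- r | P i) D (F i).
Proof. exact: (big_morph D derivationD derivation0). Qed.

Lemma derivationMn x n : D (x *+ n) = D x *+ n.
Proof. by elim: n => [|n IH]; rewrite ?mulr0n ?derivation0 // !mulrS derivationD IH. Qed.

Lemma derivationX x n : D (x ^+ n) = (x ^+ n.-1 * D x) *+ n.
Proof.
elim: n => [|n IH]; first by rewrite expr0 derivation1 mulr0n.
rewrite exprS derivationM IH /=; case: n {IH} => [|n] /=.
  by rewrite expr0 mulr0n mulr0 addr0 mulr1 mul1r mulr1n.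
rewrite mulrnAr mulrA -exprS [D x * _]mulrC.
by rewrite [in RHS]mulrS.
Qed.

End DerivationRing.

Section DerivationField.
Variables (E : fieldType) (D : E -> E) (derD : is_derivation D).

Lemma derivationV x : D x^-1 = - D x / x ^+ 2.
Proof.
have [->|x0] := eqVneq x 0.
  by rewrite invr0 derivation0 // expr0n invr0 mulr0.
apply: (mulfI x0); apply: (addrI (D x * x^-1)).
rewrite -(derivationM derD) divff // derivation1 //.
by field.
Qed.

Lemma derivation_div x y : y != 0 -> D (x / y) = (D x * y - x * D y) / y ^+ 2.
Proof. by move=> y0; rewrite derivationM // derivationV; field. Qed.

Lemma derivation_div_eq0 x y :
  y != 0 -> D (x / y) = 0 <-> D x * y = x * D y.
Proof.
move=> y0; rewrite derivation_div //; split=> [/eqP|->]; last by rewrite subrr mul0r.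
by rewrite mulf_eq0 invr_eq0 expf_eq0 /= (negPf y0) orbF subr_eq0 => /eqP.
Qed.

End DerivationField.

(** * Invariant curves of the limit equation *)

Definition coefwise (E : nzRingType) (D : E -> E) (p : {poly E}) : {poly E} :=
  \poly_(i < size p) D p`_i.

Section CoefMap.
Variables (E : fieldType) (D : E -> E) (derD : is_derivation D).

Lemma coef_coefwise p i : (coefwise D p)`_i = D p`_i.
Proof.
rewrite coef_poly; case: ltnP => // le_p_i.
by rewrite nth_default // derivation0.
Qed.

Lemma coefwise_derivation : is_derivation (coefwise D).
Proof.
split=> [p q|p q]; apply/polyP=> i.
  by rewrite coefD !coef_coefwise coefD derivationD.
rewrite coefD !coefM coef_coefwise coefM derivation_sum // -big_split /=.
by apply: eq_bigr => j _; rewrite !coef_coefwise derivationM.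
Qed.

Lemma coefwiseC a : coefwise D a%:P = (D a)%:P.
Proof.
apply/polyP=> i; rewrite coef_coefwise !coefC.
by case: eqP => // _; rewrite derivation0.
Qed.

Lemma coefwiseX : coefwise D 'X = 0.
Proof.
apply/polyP=> i; rewrite coef_coefwise coefX coef0.
by case: eqP => _; rewrite ?derivation1 ?derivation0.
Qed.
End CoefMap.

(** After removal of the common factor of [p] and [q], Gauss's lemma turns the
    vanishing of the derivative of [p / q] into divisibilities: the reduced
    numerator and denominator are Darboux polynomials of [D]. *)
Lemma der_proportional_dvdp (E : fieldType) (D : {poly E} -> {poly E}) p q :
  is_derivation D -> q != 0 -> D p * q = p * D q ->
  exists p1 q1 g, [/\ p = p1 * g, q = q1 * g, D p1 * q1 = p1 * D q1, p1 %| D p1 & q1 %| D q1].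
Proof.
move=> der q0; pose g := gcdp p q.
have g0 : g != 0 by rewrite gcdp_eq0 negb_and q0 orbT.
have [p1 [q1 [Ep Eq cop]]] : exists p1 q1, [/\ p = p1 * g, q = q1 * g & coprimep p1 q1].
  exists (p %/ g), (q %/ g); rewrite !divpK ?dvdp_gcdl ?dvdp_gcdr //.
  by split=> //; apply: coprimep_div_gcd; rewrite q0 orbT.
clearbody g; rewrite Ep Eq !(derivationM der) => Epq; exists p1, q1, g.
have {}Epq : D p1 * q1 = p1 * D q1.
  have : (D p1 * q1 - p1 * D q1) * g ^+ 2 = 0.
    by move/eqP: Epq; rewrite -subr_eq0 => /eqP <-; ring.
  by move/eqP; rewrite mulf_eq0 expf_eq0 /= (negPf g0) orbF subr_eq0 => /eqP.
split=> //; first by rewrite -(Gauss_dvdpl _ cop) Epq dvdp_mulr.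
by rewrite coprimep_sym in cop; rewrite -(Gauss_dvdpl _ cop) mulrC -Epq dvdp_mull.
Qed.

Section Darboux.
Variables (E : fieldType) (D1 D2 : E -> E) (f : E).
Hypotheses (derD1 : is_derivation D1) (derD2 : is_derivation D2).

(** The derivation of [E[u]] that a derivation [D] of a larger field induces
    when [D e = D1 e * u + D2 e] for [e] in [E] and [D u = - f * u]. *)
Definition limit_der (p : {poly E}) : {poly E} :=
  coefwise D1 p * 'X + coefwise D2 p - f *: ('X * p^`()).

Lemma limit_der_derivation : is_derivation limit_der.
Proof.
have [addD1 mulD1] := coefwise_derivation derD1.
have [addD2 mulD2] := coefwise_derivation derD2.
split=> p q; rewrite /limit_der.
  rewrite addD1 addD2 derivD -!mul_polyC; ring.
rewrite mulD1 mulD2 derivM -!mul_polyC; ring.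
Qed.

Lemma coef_limit_der p i :
  (limit_der p)`_i =
  (if i is j.+1 then D1 p`_j else 0) + D2 p`_i - f * (p`_i *+ i).
Proof.
rewrite /limit_der !coefD coefN coefZ coefMX coefXM !coef_coefwise //.
case: i => [|i] /=; first by rewrite mulr0n.
by rewrite coef_deriv.
Qed.

Lemma limit_derC a : limit_der a%:P = (D1 a) *: 'X + (D2 a)%:P.
Proof. by rewrite /limit_der !coefwiseC // derivC mulr0 scaler0 subr0 mul_polyC. Qed.

Lemma limit_derXn n : limit_der 'X^n = (- f *+ n) *: 'X^n.
Proof.
rewrite derivationX; last exact: limit_der_derivation.
rewrite /limit_der !coefwiseX // derivX mul0r !add0r mulr1.
case: n => [|n]; first by rewrite !mulr0n scale0r.
by rewrite /= -scaleNr -scalerAr -exprSr scalerMnl.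
Qed.

Lemma limit_der_monomial a n :
  limit_der (a *: 'X^n) = (D1 a *: 'X + (D2 a - f * a *+ n)%:P) * 'X^n.
Proof.
rewrite -mul_polyC (derivationM limit_der_derivation) limit_derC limit_derXn.
have -> : f * a *+ n = - (a * (- f *+ n)) by rewrite mulNrn mulrN opprK mulrnAr mulrC.
by rewrite opprK polyCD polyCM -!mul_polyC mulrA -mulrDl addrA.
Qed.

Lemma Xn_neq0 n : 'X^n != 0 :> {poly E}.
Proof. by rewrite expf_neq0 ?polyX_eq0. Qed.

(* This holds as soon as [f] has a nonzero residue at a [D2]-constant point;
   see [residue_obstruction]. *)
Hypothesis res_f : forall (n : nat) (q q0 : E),
  (0 < n)%N -> q0 != 0 -> D2 q0 != (D1 q - f *+ n) * q0.

(** If [p] is monic of degree [n], then [limit_der p] has degree at most [n],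
    so it is a multiple of [p] by a scalar [e]. The coefficients of degree [n]
    and [0] give [e = D1 p_(n-1) - n f] and [D2 p_0 = e p_0], which [res_f]
    excludes unless [n = 0]. *)
Lemma monic_darboux_eq1 p :
  p \is monic -> p`_0 != 0 -> p %| limit_der p -> p = 1.
Proof.
move=> mp p0 /dvdpP [kp Ekp].
have p_neq0 : p != 0 by rewrite monic_neq0.
have [n sz_p] : exists n, size p = n.+1.
  by move: p_neq0; rewrite -size_poly_gt0; case: (size p) => // n; exists n.
have pn : p`_n = 1 by move/monicP: mp; rewrite lead_coefE sz_p.
have size_Dp : (size (limit_der p) <= n.+1)%N.
  apply/leq_sizeP=> -[//|i] lt_ni; rewrite coef_limit_der.
  rewrite (nth_default 0 (n := i.+1)) ?sz_p // mul0rn mulr0 subr0 derivation0 // addr0.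
  move: lt_ni; rewrite ltnS leq_eqVlt => /predU1P[<-|lt_ni].
    by rewrite pn derivation1.
  by rewrite nth_default ?sz_p // derivation0.
have {}size_kp : (size kp <= 1)%N.
  have [->|kp0] := eqVneq kp 0; first by rewrite size_poly0.
  move: size_Dp; rewrite Ekp size_mul // sz_p addnS /= => h.
  by rewrite -(leq_add2r n) add1n.
have Ek := size1_polyC size_kp.
have En := congr1 (fun q : {poly E} => q`_n) Ekp.
have E0 := congr1 (fun q : {poly E} => q`_0) Ekp.
case: n => [|n] in sz_p pn En {size_Dp}.
  by move: pn; rewrite (size1_polyC (eq_leq sz_p)) coefC /= => ->.
exfalso; move: En E0; rewrite /= Ek !coefCM !coef_limit_der pn !mulr1.
rewrite (derivation1 derD2) addr0 add0r mulr0n mulr0 subr0 => En E0.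
have /eqP := @res_f n.+1 p`_n p`_0 isT p0; apply.
by rewrite E0 -En mulr_natr.
Qed.

Lemma darboux_monomial p : p != 0 -> p %| limit_der p ->
  exists (a : E) (n : nat), a != 0 /\ p = a *: 'X^n.
Proof.
have der := limit_der_derivation.
move=> p0 dvd_p; have [n [q]] := multiplicity_XsubC p 0.
rewrite p0 /= subr0 => q0 Ep.
have q_neq0 : q != 0 by apply: contraNneq p0 => q0'; rewrite Ep q0' mul0r.
have {dvd_p} dvd_q : q %| limit_der q.
  move: dvd_p; rewrite Ep (derivationM der) limit_derXn -scalerAr scalerAl -mulrDl.
  rewrite dvdp_mul2r ?expf_neq0 ?polyX_eq0 //.
  by rewrite dvdp_addl // -mul_polyC dvdp_mull.
pose a := lead_coef q; have a0 : a != 0 by rewrite lead_coef_eq0.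
have [q1 [Eq mon_q1 q1_0]] : exists q1, [/\ q = a%:P * q1, q1 \is monic & q1`_0 != 0].
  exists (a^-1 *: q); rewrite mul_polyC scalerA divff // scale1r monicE lead_coefZ.
  rewrite mulVf // eqxx; split=> //.
  by rewrite -horner_coef0 hornerZ mulf_eq0 invr_eq0 negb_or a0.
have dvd_q1 : q1 %| limit_der q1.
  have : q1 %| limit_der q by apply: dvdp_trans dvd_q; rewrite Eq dvdp_mull.
  rewrite Eq (derivationM der) dvdp_addr; last exact: dvdp_mull.
  by rewrite mul_polyC dvdpZr.
by exists a, n; split=> //; rewrite Ep Eq (monic_darboux_eq1 mon_q1) // mulr1 mul_polyC.
Qed.

(** A constant fraction reduces to [a X^n / (b X^m)] by [darboux_monomial]; the
    lowest coefficient of its derivative gives [D2 (a / b) = (n - m) f (a / b)],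
    which [res_f] excludes unless [n = m]. *)
Lemma limit_der_proportional p q :
  q != 0 -> limit_der p * q = p * limit_der q -> exists a, p = a *: q.
Proof.
have der := limit_der_derivation.
have [-> _|p0 q0] := eqVneq p 0; first by exists 0; rewrite scale0r.
move/(der_proportional_dvdp der q0) => [p1 [q1 [g [Ep Eq Epq dvd_p1 dvd_q1]]]].
have p1_0 : p1 != 0 by apply: contraNneq p0 => E0; rewrite Ep E0 mul0r.
have q1_0 : q1 != 0 by apply: contraNneq q0 => E0; rewrite Eq E0 mul0r.
rewrite Ep Eq.
have [a [n [a0 Ep1]]] := darboux_monomial p1_0 dvd_p1.
have [b [m [b0 Eq1]]] := darboux_monomial q1_0 dvd_q1.
have E1 : (D2 a - f * a *+ n) * b = a * (D2 b - f * b *+ m).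
  move: Epq; rewrite Ep1 Eq1 !limit_der_monomial -!mul_polyC.
  rewrite mulrACA [RHS]mulrACA => /(mulIf (mulf_neq0 (Xn_neq0 n) (Xn_neq0 m))).
  move/(congr1 (fun r : {poly E} => r`_0)).
  by rewrite coefMC coefCM !coefD !coefCM !coefX !coefC /= !mulr0 !add0r.
have neq (k : nat) c (c0 : c != 0) : (0 < k)%N -> D2 c <> - f *+ k * c.
  move=> k0 E0; have /eqP := @res_f k 0 c k0 c0; apply.
  by rewrite E0 derivation0 // sub0r mulNrn.
case: (ltngtP n m) => [lt_nm|lt_mn|eq_nm].
- exfalso; apply: (@neq (m - n)%N (a / b)); rewrite ?subn_gt0 ?mulf_neq0 ?invr_eq0 //.
  rewrite (derivation_div derD2) // (_ : D2 a * b - a * D2 b = - (f * a * b * (m%:R - n%:R))).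
    rewrite mulNrn -[f *+ _]mulr_natr natrB ?(ltnW lt_nm) //; by field.
  apply/eqP; rewrite -subr_eq0; apply/eqP.
  transitivity ((D2 a - f * a *+ n) * b - a * (D2 b - f * b *+ m)).
    by rewrite -!(mulr_natr (f * _)); ring.
  by rewrite E1 subrr.
- exfalso; apply: (@neq (n - m)%N (b / a)); rewrite ?subn_gt0 ?mulf_neq0 ?invr_eq0 //.
  rewrite (derivation_div derD2) // (_ : D2 b * a - b * D2 a = - (f * a * b * (n%:R - m%:R))).
    rewrite mulNrn -[f *+ _]mulr_natr natrB ?(ltnW lt_mn) //; by field.
  apply/eqP; rewrite -subr_eq0; apply/eqP.
  transitivity (a * (D2 b - f * b *+ m) - (D2 a - f * a *+ n) * b).
    by rewrite -!(mulr_natr (f * _)); ring.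
  by rewrite E1 subrr.
exists (a / b).
by rewrite Ep1 Eq1 scalerAl scalerA divfK // eq_nm.
Qed.

End Darboux.

(** * Subfields as sets and as types *)

Section Subfields.
Variables (U : fieldType) (K : set U) (subK : is_subfield K).

Lemma subfield1 : K 1. Proof. by case: subK. Qed.

Lemma subfieldB x y : K x -> K y -> K (x - y).
Proof. by case: subK => _ h _; apply: h. Qed.

Lemma subfield_div x y : K x -> K y -> K (x / y).
Proof. by case: subK => _ _ h; apply: h. Qed.

Lemma subfield0 : K 0.
Proof. by rewrite -(subrr 1); apply: subfieldB; exact: subfield1. Qed.

Lemma subfieldN x : K x -> K (- x).
Proof. by rewrite -sub0r; apply: subfieldB; exact: subfield0. Qed.

Lemma subfieldD x y : K x -> K y -> K (x + y).
Proof. by move=> Kx Ky; rewrite -[y]opprK; apply/subfieldB/subfieldN. Qed.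

Lemma subfieldV x : K x -> K x^-1.
Proof. by rewrite -[x^-1]mul1r; apply: subfield_div; exact: subfield1. Qed.

Lemma subfieldM x y : K x -> K y -> K (x * y).
Proof. by move=> Kx Ky; rewrite -[y]invrK; apply/subfield_div/subfieldV. Qed.

Lemma subfieldX x n : K x -> K (x ^+ n).
Proof.
by move=> Kx; elim: n => [|n IH]; rewrite ?expr0 ?exprS; [exact: subfield1|exact: subfieldM].
Qed.

Lemma subfield_sum (I : Type) (r : seq I) (P : pred I) (F : I -> U) :
  (forall i, P i -> K (F i)) -> K (\sum_(i <- r | P i) F i).
Proof. by move=> KF; elim/big_ind: _ => //; [exact: subfield0|exact: subfieldD]. Qed.

Lemma subfield_prod (I : Type) (r : seq I) (P : pred I) (F : I -> U) :
  (forall i, P i -> K (F i)) -> K (\prod_(i <- r | P i) F i).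
Proof. by move=> KF; elim/big_ind: _ => //; [exact: subfield1|exact: subfieldM]. Qed.

Lemma subfield_horner (p : {poly U}) x : (forall i, K p`_i) -> K x -> K p.[x].
Proof.
move=> Kp Kx; rewrite horner_coef; apply: subfield_sum => i _.
by apply: subfieldM => //; exact: subfieldX.
Qed.

Lemma subfield_meval n (p : {mpoly U[n]}) (t : 'I_n -> U) :
  (forall m, K p@_m) -> (forall i, K (t i)) -> K p.@[t].
Proof.
move=> Kp Kt; rewrite mevalE; apply: subfield_sum => m _.
by apply: subfieldM => //; apply: subfield_prod => i _; exact: subfieldX.
Qed.

Definition in_K : {pred U} := fun x => `[< K x >].

Fact in_K_divring_closed : divring_closed in_K.
Proof.
split=> [|x y /asboolP Kx /asboolP Ky|x y /asboolP Kx /asboolP Ky]; apply/asboolP.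
- exact: subfield1.
- exact: subfieldB.
- exact: subfield_div.
Qed.

HB.instance Definition _ := GRing.isDivringClosed.Build U in_K in_K_divring_closed.

Definition sub_type := {x : U | x \in in_K}.
HB.instance Definition _ := SubChoice.on sub_type.
HB.instance Definition _ := [SubChoice_isSubIntegralDomain of sub_type by <:].
HB.instance Definition _ := [SubIntegralDomain_isSubField of sub_type by <:].

(** Subfields are sets in the statements and types in the proofs, where
    polynomials over them have a division. *)
Lemma subfield_typeP :
  exists (k : fieldType) (phi : {rmorphism k -> U}), K = range phi.
Proof.
exists sub_type, (val : {rmorphism sub_type -> U}).
apply/seteqP; split=> [x /asboolP Kx|_ [x _ <-]]; last exact/asboolP/(svalP x).
by exists (exist _ x Kx).
Qed.

End Subfields.

(** * Generated fields *)

Section Generation.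
Variable U : fieldType.
Implicit Types (X K L : set U).

Lemma field_gen_subfield X : is_subfield (field_gen X).
Proof.
split=> [L [] //|x y Xx Xy L subL XL|x y Xx Xy L subL XL].
  by apply: subfieldB => //; [exact: Xx|exact: Xy].
by apply: subfield_div => //; [exact: Xx|exact: Xy].
Qed.

Lemma sub_field_gen X : X `<=` field_gen X.
Proof. by move=> x Xx L _; apply. Qed.

Lemma field_gen_min X L : is_subfield L -> X `<=` L -> field_gen X `<=` L.
Proof. by move=> subL XL x; apply. Qed.

Lemma field_gen_mono X L : X `<=` L -> field_gen X `<=` field_gen L.
Proof.
by move=> XL; apply: field_gen_min; [exact: field_gen_subfield|exact: subset_trans (@sub_field_gen L)].
Qed.

Variable d : U -> U.

Lemma diff_field_gen_diff X : is_diff_subfield d (diff_field_gen d X).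
Proof.
split; last by move=> x Xx L dL XL; apply: dL.2; exact: Xx.
split=> [L [[] //]|x y Xx Xy L dL XL|x y Xx Xy L dL XL].
  by apply: (subfieldB dL.1); [exact: Xx|exact: Xy].
by apply: (subfield_div dL.1); [exact: Xx|exact: Xy].
Qed.

Lemma sub_diff_field_gen X : X `<=` diff_field_gen d X.
Proof. by move=> x Xx L _; apply. Qed.

Lemma diff_field_gen_min X L :
  is_diff_subfield d L -> X `<=` L -> diff_field_gen d X `<=` L.
Proof. by move=> dL XL x; apply. Qed.

Lemma range_subfield (k : fieldType) (phi : {rmorphism k -> U}) : is_subfield (range phi).
Proof.
split=> [|_ _ [x _ <-] [y _ <-]|_ _ [x _ <-] [y _ <-]].
- by exists 1; rewrite ?rmorph1.
- by exists (x - y); rewrite ?rmorphB.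
- by exists (x / y); rewrite ?fmorph_div.
Qed.

Section Fractions.
Variable S : set U.
Hypotheses (S1 : S 1) (SB : forall x y, S x -> S y -> S (x - y))
  (SM : forall x y, S x -> S y -> S (x * y)).

Definition fractions : set U :=
  [set x | exists a b, [/\ S a, S b, b != 0 & x = a / b]].

Lemma sub_fractions : S `<=` fractions.
Proof. by move=> a Sa; exists a, 1; rewrite oner_neq0 divr1. Qed.

Lemma fractions_subfield : is_subfield fractions.
Proof.
split=> [|_ _ [a [b [Sa Sb b0 ->]]] [a' [b' [Sa' Sb' b'0 ->]]]
         |_ _ [a [b [Sa Sb b0 ->]]] [a' [b' [Sa' Sb' b'0 ->]]]].
- by exists 1, 1; rewrite oner_neq0 divr1.
- exists (a * b' - a' * b), (b * b'); split; [by apply: SB; apply: SM|exact: SM| |].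
    by rewrite mulf_neq0.
  by field; rewrite b0 b'0.
- have [->|a'0] := eqVneq a' 0.
    by exists 0, 1; rewrite oner_neq0 !(mul0r, invr0, mulr0) -(subrr 1); split=> //; exact: SB.
  exists (a * b'), (b * a'); split; [exact: SM|exact: SM|by rewrite mulf_neq0|].
  by field; rewrite b0 a'0 b'0.
Qed.

Lemma field_gen_fractions X : X `<=` S -> field_gen X `<=` fractions.
Proof.
move=> XS; apply: field_gen_min; first exact: fractions_subfield.
by apply: subset_trans XS _; exact: sub_fractions.
Qed.

Lemma common_denominator (r : seq U) : (forall x, x \in r -> fractions x) ->
  exists b, [/\ S b, b != 0 & forall x, x \in r -> S (b * x)].
Proof.
elim: r => [|x r IH] frac_r; first by exists 1; rewrite oner_neq0.
have [|b [Sb b0 bP]] := IH; first by move=> y ry; apply: frac_r; rewrite inE ry orbT.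
have [a' [b' [Sa' Sb' b'0 Ex]]] := frac_r x (mem_head x r).
exists (b' * b); split; [exact: SM|by rewrite mulf_neq0|move=> y].
rewrite inE => /predU1P[->|/bP Sy]; last by rewrite -mulrA; exact: SM.
rewrite (_ : b' * b * x = a' * b); first exact: SM.
by rewrite Ex; field.
Qed.

End Fractions.

Section RangeFractions.
Variables (R : comNzRingType) (phi : {rmorphism R -> U}).

Lemma range_subring : [/\ range phi 1, forall x y, range phi x -> range phi y -> range phi (x - y)
  & forall x y, range phi x -> range phi y -> range phi (x * y)].
Proof.
split=> [|_ _ [x _ <-] [y _ <-]|_ _ [x _ <-] [y _ <-]].
- by exists 1; rewrite ?rmorph1.
- by exists (x - y); rewrite ?rmorphB.
- by exists (x * y); rewrite ?rmorphM.
Qed.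

Lemma field_gen_range X : X `<=` range phi ->
  forall x, field_gen X x -> exists a b, phi b != 0 /\ x = phi a / phi b.
Proof.
have [phi1 phiB phiM] := range_subring.
move=> Xphi x /(field_gen_fractions phi1 phiB phiM Xphi).
by move=> [_ [_ [[a _ <-] [b _ <-] b0 ->]]]; exists a, b.
Qed.

End RangeFractions.

Lemma adjoin1P (k : fieldType) (phi : {rmorphism k -> U}) x y :
  field_gen (range phi `|` [set x]) y ->
  exists p q : {poly k}, (map_poly phi q).[x] != 0 /\
    y = (map_poly phi p).[x] / (map_poly phi q).[x].
Proof.
pose ev : {rmorphism {poly k} -> U} := horner_eval x \o map_poly phi.
apply: (field_gen_range (phi := ev)) => _ [[a _ <-]|->].
  by exists a%:P => //; rewrite /= map_polyC horner_evalE hornerC.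
by exists 'X => //; rewrite /= map_polyX horner_evalE hornerX.
Qed.

Lemma adjoinP (k : fieldType) (phi : {rmorphism k -> U}) n (t : 'I_n -> U) y :
  field_gen (range phi `|` range t) y ->
  exists p q : {mpoly k[n]}, mmap phi t q != 0 /\ y = mmap phi t p / mmap phi t q.
Proof.
apply: (field_gen_range (phi := mmap phi t)) => _ [[a _ <-]|[i _ <-]].
  by exists a%:MP => //=; rewrite mmapC.
by exists 'X_i => //=; rewrite mmapX mmap1U.
Qed.

Lemma lift_poly (k : fieldType) (phi : {rmorphism k -> U}) (p : {poly U}) :
  (forall i, range phi p`_i) -> exists q, map_poly phi q = p.
Proof.
move=> Kp; have /choice [f Ef] : forall i, exists a, phi a = p`_i.
  by move=> i; have [a _ Ea] := Kp i; exists a.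
exists (\poly_(i < size p) f i); apply/polyP=> i; rewrite coef_map coef_poly /=.
by case: ltnP => [_ //|le_pi]; rewrite rmorph0 nth_default.
Qed.

Lemma algebraic_overP (k : fieldType) (phi : {rmorphism k -> U}) x :
  algebraic_over (range phi) x <-> algebraicOver phi x.
Proof.
split=> [[p [p0 Kp px]]|[p p0 px]].
  have [q Eq] := lift_poly Kp; exists q; last by rewrite Eq.
  by apply: contraNneq p0 => E0; rewrite -Eq E0 rmorph0.
exists (map_poly phi p); rewrite map_poly_eq0; split=> // i.
by rewrite coef_map; exists p`_i.
Qed.

Lemma algebraic_over_id K x : is_subfield K -> K x -> algebraic_over K x.
Proof.
move=> subK; have [k [phi EK]] := subfield_typeP subK.
by rewrite EK => -[a _ <-]; apply/algebraic_overP/algebraic_id.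
Qed.

Lemma algebraic_over_mono K L x : K `<=` L -> algebraic_over K x -> algebraic_over L x.
Proof. by move=> KL [p [p0 Kp px]]; exists p; split=> // i; apply: KL. Qed.

Lemma algebraic_over_subfield K : is_subfield K -> is_subfield (algebraic_over K).
Proof.
move=> subK; have [k [phi EK]] := subfield_typeP subK.
rewrite EK; split=> [|x y|x y]; rewrite ?algebraic_overP.
- exact: algebraic1.
- exact: algebraic_sub.
- exact: algebraic_div.
Qed.

Lemma algebraic_over_trans K x : is_subfield K ->
  algebraic_over (algebraic_over K) x -> algebraic_over K x.
Proof.
move=> subK; have [k [phi EK]] := subfield_typeP subK.
rewrite EK => -[p [p0 Kp px]].
rewrite algebraic_overP integral_algebraic.
apply: (integral_root p0 px) => _ /(nthP 0) [i _ <-].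
by rewrite -integral_algebraic -algebraic_overP.
Qed.

End Generation.

(** * Algebraic independence *)

Lemma mmap_map_mpoly (R S : comNzRingType) (phi : {rmorphism R -> S}) n (t : 'I_n -> S) G :
  mmap phi t G = (map_mpoly phi G).@[t].
Proof.
rewrite /meval (mmapE (msize G + msize (map_mpoly phi G))) ?leq_addr //.
rewrite (mmapE (msize G + msize (map_mpoly phi G))) ?leq_addl //.
by apply: eq_bigr => m _; rewrite mcoeff_map_mpoly.
Qed.

Section Independence.
Variables (U k : fieldType) (phi : {rmorphism k -> U}).

Lemma alg_independentP n (t : 'I_n -> U) :
  alg_independent (range phi) t <->
  (forall P : {mpoly k[n]}, mmap phi t P = 0 -> P = 0).
Proof.
split=> [ind P P0|ind P KP P0].
  have EP : map_mpoly phi P = 0.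
    by apply: ind; [move=> m; rewrite mcoeff_map_mpoly; exists P@_m|rewrite -mmap_map_mpoly].
  apply/mpolyP=> m; apply: (fmorph_inj phi).
  by rewrite -mcoeff_map_mpoly EP !mcoeff0 rmorph0.
have /choice [f Ef] : forall m, exists a, phi a = P@_m.
  by move=> m; have [a _ Ea] := KP m; exists a.
pose Q : {mpoly k[n]} := \sum_(m <- msupp P) f m *: 'X_[m].
have EQ : map_mpoly phi Q = P.
  rewrite [in RHS](mpolyE P) rmorph_sum; apply: eq_bigr => m _ /=.
  by rewrite map_mpolyZ map_mpolyX Ef.
by rewrite -EQ (ind Q) ?rmorph0 // mmap_map_mpoly EQ.
Qed.

Lemma muni_mwiden (R : comNzRingType) n (p : {mpoly R[n]}) : muni (mwiden p) = p%:P.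
Proof.
rewrite [in LHS](mpolyE p) (raddf_sum (@mwiden n R)) (raddf_sum (@muni n R)).
rewrite [in RHS](mpolyE p) rmorph_sum.
apply: eq_bigr => m _ /=; rewrite mwidenZ muniZ mwidenX muniE msuppX big_seq1.
rewrite mcoeffX eqxx scale1r mnmwiden_ordmax expr0 alg_polyC -mul_polyC -polyCM mul_mpolyC.
congr (_ *: 'X_[_])%:P.
by apply/mnmP=> i; rewrite mnmE mnmwiden_widen.
Qed.

Lemma muniX (R : comNzRingType) n : muni ('X_ord_max : {mpoly R[n.+1]}) = 'X.
Proof.
rewrite muniE msuppX big_seq1 mcoeffX eqxx scale1r mnm1E eqxx expr1.
rewrite (_ : [multinom _ | _ < n] = 0%MM) ?mpolyX0 ?scale1r //.
apply/mnmP=> i; rewrite mnmE mnm0E mnm1E.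
by rewrite -val_eqE /= gtn_eqF.
Qed.

Definition mpoly_of_uni (R : comNzRingType) n (p : {poly {mpoly R[n]}}) : {mpoly R[n.+1]} :=
  (map_poly (@mwiden n R) p).['X_ord_max].

Lemma mpoly_of_uniK (R : comNzRingType) n : cancel (@mpoly_of_uni R n) (@muni n R).
Proof.
move=> p; rewrite /mpoly_of_uni -[in RHS](coefK p) poly_def horner_coef rmorph_sum.
rewrite size_map_inj_poly ?mwiden0 //; last exact: inj_mwiden.
apply: eq_bigr => i _; rewrite /= rmorphM rmorphXn /= coef_map_id0 ?mwiden0 //.
by rewrite muni_mwiden muniX mul_polyC.
Qed.

Lemma muniK (R : comNzRingType) n : cancel (@muni n R) (@mpoly_of_uni R n).
Proof.
move=> p; rewrite muniE /mpoly_of_uni rmorph_sum horner_sum [RHS](mpolyE p).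
apply: eq_bigr => m _; rewrite -mul_polyC rmorphM /= map_polyC map_polyXn hornerM.
rewrite hornerC hornerXn /= mwidenZ mwidenX -scalerAl mpolyXn -mpolyXD.
congr (_ *: 'X_[_]); apply/mnmP=> i; rewrite mnmDE mulmnE mnm1E.
have [<-|ne_i] := eqVneq ord_max i; first by rewrite mnmwiden_ordmax mul1n.
have lt_in : (i < n)%N.
  by have := ltn_ord i; rewrite ltnS leq_eqVlt => /predU1P[Ei|//]; case/eqP: ne_i; apply/val_inj.
have -> : i = widen_ord (leqnSn n) (Ordinal lt_in) by apply/val_inj.
by rewrite mnmwiden_widen mnmE mul0n addn0.
Qed.

Lemma mmap_mwiden n (t : 'I_n.+1 -> U) (p : {mpoly k[n]}) :
  mmap phi t (mwiden p) = mmap phi (fun i => t (widen_ord (leqnSn n) i)) p.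
Proof.
rewrite (mpolyE p) (raddf_sum (@mwiden n k)) !(raddf_sum (mmap phi _)) /=.
apply: eq_bigr => m _; rewrite mwidenZ !mmapZ mwidenX !mmapX /mmap1 big_ord_recr /= mnmwiden_ordmax expr0 mulr1.
by congr (_ * _); apply: eq_bigr => i _; rewrite mnmwiden_widen.
Qed.

Lemma mmap_muni n (t : 'I_n.+1 -> U) (p : {mpoly k[n.+1]}) :
  mmap phi t p =
  (map_poly (mmap phi (fun i => t (widen_ord (leqnSn n) i))) (muni p)).[t ord_max].
Proof.
rewrite muniE rmorph_sum horner_sum [LHS]/mmap; apply: eq_bigr => m _.
rewrite -mul_polyC rmorphM /= map_polyC map_polyXn hornerM hornerC hornerXn.
rewrite /= mmapZ mmapX -mulrA; congr (_ * _).
rewrite /mmap1 big_ord_recr /=; congr (_ * _).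
by apply: eq_bigr => i _; rewrite mnmE.
Qed.

(** Isolating the last variable: a relation between [w 0, ..., w n] is a
    polynomial equation for [w n] over the field of the previous ones. *)
Lemma tail_independentP n (w : nat -> U) :
  alg_independent (range phi) (fun i : 'I_n.+1 => w i) <->
  alg_independent (range phi) (fun i : 'I_n => w i) /\
  ~ algebraic_over (field_gen (range phi `|` range (fun i : 'I_n => w i))) (w n).
Proof.
set L := field_gen _; rewrite !alg_independentP.
pose ev := mmap phi (fun i : 'I_n => w i).
have subL : is_subfield L by exact: field_gen_subfield.
have Lev p : L (ev p).
  apply: (subfield_sum subL) => m _; apply: (subfieldM subL).
    by apply: sub_field_gen; left; exists p@_m.
  apply: (subfield_prod subL) => i _; apply: (subfieldX subL).
  by apply: sub_field_gen; right; exists i.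
split=> [ind|[ind trans] P P0].
  split=> [P P0|[p [p0 Lp pw]]].
    by apply: (@inj_mwiden n k); rewrite mwiden0; apply: ind; rewrite mmap_mwiden.
  have [ev1 evB evM] := range_subring (mmap phi (fun i : 'I_n => w i)).
  have [|_ [[b _ <-] b0 bP]] := common_denominator ev1 evM (r := p).
    move=> _ /(nthP 0) [i _ <-]; have [a' [b' [b'0 ->]]] := adjoinP (Lp i).
    by exists (ev a'), (ev b'); split=> //.
  have /choice [f Ef] : forall i, exists a, ev a = ev b * p`_i.
    move=> i; have [lt_ip|le_pi] := ltnP i (size p).
      by have [a _ Ea] := bP _ (mem_nth 0 lt_ip); exists a.
    by exists 0; rewrite [LHS]mmap0 nth_default ?mulr0.
  pose q : {poly {mpoly k[n]}} := \poly_(i < size p) f i.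
  have Eq : map_poly ev q = ev b *: p.
    apply/polyP=> i; rewrite coef_map coef_poly coefZ /=.
    by case: ltnP => [_ //|le_pi]; rewrite [LHS]mmap0 nth_default ?mulr0.
  have q0 : q = 0.
    rewrite -[q]mpoly_of_uniK (ind (mpoly_of_uni q)) ?raddf0 //.
    rewrite mmap_muni mpoly_of_uniK [map_poly _ _]Eq hornerZ.
    by move/rootP: pw => ->; rewrite mulr0.
  move/eqP: Eq; rewrite q0 rmorph0 eq_sym scaler_eq0 (negPf p0) orbF.
  by apply/negP.
have uP0 : muni P = 0.
  have Ep : map_poly ev (muni P) = 0.
    apply: contra_notP trans => /eqP pn0; exists (map_poly ev (muni P)); split=> //.
      by move=> i; rewrite coef_map; exact: Lev.
    by rewrite rootE -[X in _ == X]P0 mmap_muni.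
  apply/polyP=> i; rewrite coef0; apply: ind.
  by rewrite -[RHS](coef0 U i) -Ep coef_map.
by apply: (can_inj (@muniK k n)); rewrite uP0 raddf0.
Qed.

End Independence.

Section Transcendence.
Variables (U : fieldType) (K : set U) (subK : is_subfield K).

Lemma independent_tail n (w : nat -> U) :
  alg_independent K (fun i : 'I_n.+1 => w i) <->
  alg_independent K (fun i : 'I_n => w i) /\
  ~ algebraic_over (field_gen (K `|` range (fun i : 'I_n => w i))) (w n).
Proof.
by have [k [phi ->]] := subfield_typeP subK; exact: tail_independentP.
Qed.

Lemma range_ord0 (w : nat -> U) : range (fun i : 'I_0 => w i) = set0.
Proof. by rewrite -subset0 => y [i _ _]; case: i. Qed.

Lemma independent0 (w : nat -> U) : alg_independent K (fun i : 'I_0 => w i).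
Proof.
move=> P _; rewrite [P](mpolyE P) => P0; apply/mpolyP=> m; rewrite mcoeff0.
have Em m' : m' = 0%MM :> 'X_{1..0} by apply/mnmP; case.
move: P0; rewrite -mpolyE mevalE (Em m).
have [PO|nP0] := eqVneq (P@_0) 0; first by [].
rewrite (_ : msupp P = [:: 0%MM]) ?big_seq1 ?big_ord0 ?mulr1 //.
have u := msupp_uniq P.
have : 0%MM \in msupp P by rewrite mcoeff_msupp.
case: (msupp P) u => // m1 s; rewrite (Em m1); case: s => // m2 s.
by rewrite (Em m2) /= inE eqxx.
Qed.

Lemma independent_chain n (w : nat -> U) :
  (forall i, (i < n)%N ->
     ~ algebraic_over (field_gen (K `|` range (fun j : 'I_i => w j))) (w i)) ->
  alg_independent K (fun i : 'I_n => w i).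
Proof.
elim: n => [|n IH] trans; first exact: independent0.
apply/independent_tail; split; last exact: trans.
by apply: IH => i lt_in; apply: trans; exact: ltnW.
Qed.

Lemma meval_msym n (s : 'S_n) (P : {mpoly U[n]}) (t : 'I_n -> U) :
  (msym s P).@[t] = P.@[t \o s].
Proof.
rewrite (mpolyE P) (raddf_sum (msym s)) !raddf_sum; apply: eq_bigr => m _ /=.
rewrite msymZ !mevalZ msymX !mevalX; congr (_ * _).
rewrite [LHS](reindex_inj (@perm_inj _ s)) /=; apply: eq_bigr => i _.
by rewrite mnmE permK.
Qed.

Lemma independent_perm n (s : 'S_n) (t : 'I_n -> U) :
  alg_independent K t -> alg_independent K (t \o s).
Proof.
move=> ind P KP P0; apply: (inj_msym s); rewrite msym0; apply: ind.
  by move=> m; rewrite mcoeff_sym.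
by rewrite meval_msym.
Qed.

Definition pair_fun (x y : U) : nat -> U := fun i => if i is 0 then x else y.

Lemma range_ord1 (w : nat -> U) : range (fun i : 'I_1 => w i) = [set w 0].
Proof.
by apply/seteqP; split=> [_ [i _ <-]|_ ->]; [rewrite ord1|exists ord0].
Qed.

Lemma field_gen_id (L : set U) : is_subfield L -> field_gen L = L.
Proof.
by move=> subL; apply/seteqP; split; [exact: field_gen_min|exact: sub_field_gen].
Qed.

Lemma independent2P x y :
  alg_independent K (fun i : 'I_2 => pair_fun x y i) <->
  ~ algebraic_over K x /\ ~ algebraic_over (field_gen (K `|` [set x])) y.
Proof.
rewrite !independent_tail range_ord0 setU0 range_ord1 field_gen_id //=.
by split=> [[[_ ? ?]]|[? ?]]; do ?split=> //; exact: independent0.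
Qed.

Lemma independent2C x y :
  alg_independent K (fun i : 'I_2 => pair_fun x y i) ->
  alg_independent K (fun i : 'I_2 => pair_fun y x i).
Proof.
move=> ind; have := independent_perm (s := tperm ord0 ord_max) ind.
rewrite (_ : _ \o _ = fun i : 'I_2 => pair_fun y x i) //.
apply: funext => -[[|[|//]] lt_i] /=.
  by rewrite (_ : Ordinal _ = ord0) ?tpermL //; apply/val_inj.
by rewrite (_ : Ordinal _ = ord_max) ?tpermR //; apply/val_inj.
Qed.

Lemma algebraic_exchange t b :
  algebraic_over (field_gen (K `|` [set b])) t -> ~ algebraic_over K t ->
  algebraic_over (field_gen (K `|` [set t])) b.
Proof.
move=> algt trt; apply: contrapT => trb.
by have /independent2P/independent2C/independent2P [] := conj trt trb.
Qed.

(** If [x] and [y] were dependent, the field would be algebraic over [K(b)] with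
    [b] one of them; by exchange [b] would be algebraic over [K(t_0)] for any
    transcendental [t_0] of the field, leaving no room for an independent
    [t_1]. *)
Lemma trdeg2_independent x y :
  has_trdeg K (field_gen (K `|` [set x; y])) 2 ->
  alg_independent K (fun i : 'I_2 => pair_fun x y i).
Proof.
move=> [t [Lt indt _]]; apply: contrapT => dep.
have {indt} : alg_independent K (fun i : 'I_2 => pair_fun (t ord0) (t ord_max) i).
  rewrite (_ : (fun i : 'I_2 => _) = t) //; apply: funext => -[[|[|//]] lt_i] /=.
    by congr (t _); apply/val_inj.
  by congr (t _); apply/val_inj.
move/independent2P => [tr0 tr1].
have [b algL] : exists b,
    forall z, field_gen (K `|` [set x; y]) z -> algebraic_over (field_gen (K `|` [set b])) z.
  have subb b : is_subfield (algebraic_over (field_gen (K `|` [set b]))).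
    exact/algebraic_over_subfield/field_gen_subfield.
  have gen b z : (K `|` [set b]) z -> algebraic_over (field_gen (K `|` [set b])) z.
    by move=> Kz; apply: algebraic_over_id; [exact: field_gen_subfield|exact: sub_field_gen].
  have [algx|trx] := pselect (algebraic_over K x).
    exists y; apply: field_gen_min => // z [Kz|[->|->]]; [by apply: gen; left| |by apply: gen; right].
    by apply: algebraic_over_mono algx => z' Kz'; apply: sub_field_gen; left.
  have [algy|tr_y] := pselect (algebraic_over (field_gen (K `|` [set x])) y).
    by exists x; apply: field_gen_min => // z [Kz|[->|->]] //; apply: gen; [left|right].
  by case: dep; apply/independent2P.
have algb : algebraic_over (field_gen (K `|` [set t ord0])) b.
  exact: (algebraic_exchange (algL _ (Lt ord0)) tr0).
apply: tr1; apply: algebraic_over_trans; first exact: field_gen_subfield.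
apply: algebraic_over_mono (algL _ (Lt ord_max)).
apply: field_gen_min; first exact/algebraic_over_subfield/field_gen_subfield.
move=> z [Kz|->//]; apply: algebraic_over_id; first exact: field_gen_subfield.
by apply: sub_field_gen; left.
Qed.

End Transcendence.

(** * Residues over a rational function field *)

Section Residue.
Variables (F E : fieldType) (eta : {rmorphism F -> E}) (x : E).
Local Notation ev p := (map_poly eta p).[x].
Hypothesis trx : forall p, ev p = 0 -> p = 0.
Hypothesis genx : forall e : E, exists p q, ev q != 0 /\ e = ev p / ev q.
Variables (D1 D2 : E -> E) (derD1 : is_derivation D1) (derD2 : is_derivation D2).
Variable dF : F -> F.
Hypotheses (D1eta : forall a, D1 (eta a) = 0) (D1x : D1 x = 1).
Hypotheses (D2eta : forall a, D2 (eta a) = eta (dF a)) (D2x : D2 x = 0).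
Hypothesis char0 : [pchar E] =i pred0.
Variable c : F.
Hypothesis D2c : D2 (eta c) = 0.

Let evD p q : ev (p + q) = ev p + ev q.
Proof. by rewrite rmorphD hornerD. Qed.
Let evN p : ev (- p) = - ev p.
Proof. by rewrite rmorphN hornerN. Qed.
Let evM p q : ev (p * q) = ev p * ev q.
Proof. by rewrite rmorphM hornerM. Qed.
Let evC a : ev a%:P = eta a.
Proof. by rewrite map_polyC hornerC. Qed.
Let evX : ev 'X = x.
Proof. by rewrite map_polyX hornerX. Qed.
Let ev_neq0 p : p != 0 -> ev p != 0.
Proof. by apply: contra_neq => /trx. Qed.

Let D1ev p : D1 (ev p) = ev p^`().
Proof.
elim/poly_ind: p => [|p a IH].
  by rewrite deriv0 !rmorph0 !horner0 derivation0.
rewrite derivD derivM derivX derivC addr0 mulr1 !(evD, evM, evX, evC).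
by rewrite derivationD // derivationM // D1eta D1x IH mulr1 addr0.
Qed.

Let D2ev p : exists q, D2 (ev p) = ev q.
Proof.
elim/poly_ind: p => [|p a [q Eq]]; first by exists 0; rewrite !rmorph0 !horner0 derivation0.
exists (q * 'X + (dF a)%:P); rewrite !(evD, evM, evX, evC).
by rewrite derivationD // derivationM // D2eta D2x Eq mulr0 addr0.
Qed.

(** The local ring of the point [c] of the line with coordinate [x]. *)
Definition regular (e : E) := exists p q, q.[c] != 0 /\ e = ev p / ev q.

Let root_neq0 q : q.[c] != 0 -> q != 0.
Proof. by apply: contraNneq => ->; rewrite horner0. Qed.

Lemma regular_poly p : regular (ev p).
Proof. by exists p, 1; rewrite hornerC oner_neq0 evC rmorph1 divr1. Qed.

Lemma regularD e1 e2 : regular e1 -> regular e2 -> regular (e1 + e2).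
Proof.
move=> [p1 [q1 [q1c ->]]] [p2 [q2 [q2c ->]]].
exists (p1 * q2 + p2 * q1), (q1 * q2); rewrite hornerM mulf_neq0 //; split=> //.
by rewrite evD !evM; field; rewrite !ev_neq0 ?root_neq0.
Qed.

Lemma regularM e1 e2 : regular e1 -> regular e2 -> regular (e1 * e2).
Proof.
move=> [p1 [q1 [q1c ->]]] [p2 [q2 [q2c ->]]].
exists (p1 * p2), (q1 * q2); rewrite hornerM mulf_neq0 //; split=> //.
by rewrite !evM; field; rewrite !ev_neq0 ?root_neq0.
Qed.

Lemma regularN e : regular e -> regular (- e).
Proof.
move=> re; rewrite -mulN1r; apply: regularM => //.
by rewrite -(rmorph1 eta) -rmorphN -evC; exact: regular_poly.
Qed.

Lemma regularB e1 e2 : regular e1 -> regular e2 -> regular (e1 - e2).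
Proof. by move=> r1 r2; apply/regularD/regularN. Qed.

Lemma regular_eta a : regular (eta a).
Proof. by rewrite -evC; exact: regular_poly. Qed.

Lemma regular_nat n : regular n%:R.
Proof. by rewrite -(rmorph_nat eta); exact: regular_eta. Qed.

Let regular_der (D : E -> E) (derD : is_derivation D)
  (Dev : forall p, exists q, D (ev p) = ev q) e : regular e -> regular (D e).
Proof.
move=> [p [q [qc ->]]]; have q0 : ev q != 0 by rewrite ev_neq0 ?root_neq0.
have [p' Ep] := Dev p; have [q' Eq] := Dev q.
exists (p' * q - p * q'), (q ^+ 2); rewrite horner_exp expf_neq0 //; split=> //.
by rewrite derivation_div // Ep Eq rmorphXn /= horner_exp evD evN !evM.
Qed.

Lemma regular_D1 e : regular e -> regular (D1 e).
Proof. by apply: regular_der => // p; exists p^`(). Qed.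

Lemma regular_D2 e : regular e -> regular (D2 e).
Proof. exact: regular_der. Qed.

Let pi : E := x - eta c.

Let evpi : ev ('X - c%:P) = pi.
Proof. by rewrite evD evN evX evC. Qed.

Lemma pi_neq0 : pi != 0.
Proof. by rewrite -evpi ev_neq0 // polyXsubC_eq0. Qed.

Lemma pi_not_unit : ~ regular pi^-1.
Proof.
move=> [p [q [qc Epi]]].
have q0 : ev q != 0 by rewrite ev_neq0 ?root_neq0.
have Eq : q = p * ('X - c%:P).
  apply/eqP; rewrite -subr_eq0; apply/eqP/trx.
  rewrite evD evN evM evpi; apply/eqP; rewrite subr_eq0; apply/eqP.
  by apply: (mulIf (invr_neq0 q0)); rewrite mulrAC -Epi mulVf ?pi_neq0 // divff.
by move: qc; rewrite Eq !hornerE subrr mulr0 eqxx.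
Qed.

Lemma pi_factor e : e != 0 -> exists (n : nat) (v : E),
  [/\ regular v, regular v^-1 & e = v * pi ^+ n \/ e = v / pi ^+ n].
Proof.
move=> e0; have [p [q [q0 Ee]]] := genx e.
have p0 : p != 0.
  by apply: contraNneq e0 => p0; rewrite Ee p0 rmorph0 horner0 mul0r.
have [m [p1]] := multiplicity_XsubC p c; rewrite p0 /= => p1c Ep.
have {}q0 : q != 0 by apply: contraNneq q0 => ->; rewrite rmorph0 horner0.
have [l [q1]] := multiplicity_XsubC q c; rewrite q0 /= => q1c Eq.
have Eev r k : ev (r * ('X - c%:P) ^+ k) = ev r * pi ^+ k.
  by rewrite evM rmorphXn /= horner_exp evpi.
have v0 := pi_neq0.
have {}p1c : p1.[c] != 0 by [].
have {}q1c : q1.[c] != 0 by [].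
have ep1 : ev p1 != 0 by rewrite ev_neq0 ?root_neq0.
have eq1 : ev q1 != 0 by rewrite ev_neq0 ?root_neq0.
have {}Ee : e = ev p1 / ev q1 * (pi ^+ m / pi ^+ l).
  by rewrite Ee Ep Eq !Eev; field; rewrite expf_neq0 // eq1.
have rv : regular (ev p1 / ev q1) by exists p1, q1.
have rv' : regular (ev p1 / ev q1)^-1 by exists q1, p1; rewrite invf_div.
have [le_lm|lt_ml] := leqP l m.
  by exists (m - l)%N, (ev p1 / ev q1); split=> //; left; rewrite Ee -expfB_cond ?(negPf v0).
exists (l - m)%N, (ev p1 / ev q1); split=> //; right.
by rewrite Ee -invf_div -expfB_cond ?(negPf v0) // ltnW.
Qed.

Lemma D1pi n : D1 (pi ^+ n) = pi ^+ n.-1 *+ n.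
Proof. by rewrite derivationX // /pi derivationB // D1eta D1x subr0 mulr1. Qed.

Lemma D2pi n : D2 (pi ^+ n) = 0.
Proof. by rewrite derivationX // /pi derivationB // D2c D2x subr0 mulr0 mul0rn. Qed.

(** Since [D2 pi = 0], a power of [pi] contributes nothing to a logarithmic
    [D2]-derivative, and only that of a unit at [c] remains. *)
Lemma regular_logder e : e != 0 -> regular (D2 e / e).
Proof.
move=> e0; have [n [v [rv rv' Ee]]] := pi_factor e0.
have v0 : v != 0 by apply: contraNneq e0 => v0; case: Ee => ->; rewrite v0 mul0r.
have pn0 : pi ^+ n != 0 by rewrite expf_neq0 ?pi_neq0.
suff -> : D2 e / e = D2 v / v by apply: regularM => //; exact: regular_D2.
case: Ee => ->.
  by rewrite derivationM // D2pi; field; rewrite v0.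
by rewrite derivation_div // D2pi; field; rewrite v0.
Qed.

(** The derivative of a unit times [pi ^ n] has order [n - 1] at [c] for [n != 0]
    and is regular for [n = 0], so it is never a simple pole. *)
Lemma D1_residue e a : a != 0 -> ~ regular (D1 e - eta a / pi).
Proof.
move=> a0 reg; apply: pi_not_unit.
have ea0 : eta a != 0 by rewrite fmorph_eq0.
have p0 := pi_neq0.
have reg_e : regular e -> regular pi^-1.
  move=> re; rewrite (_ : _^-1 = eta a^-1 * (D1 e - (D1 e - eta a / pi))).
    by apply: regularM; [exact: regular_eta|apply: regularB => //; exact: regular_D1].
  by rewrite fmorphV; field; rewrite p0 ea0.
have [e0|e0] := eqVneq e 0.
  by apply: reg_e; rewrite e0 -(rmorph0 eta); exact: regular_eta.
have [n [v [rv rv' Ee]]] := pi_factor e0.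
have regpi k : regular (pi ^+ k).
  by rewrite -evpi -horner_exp -rmorphXn; exact: regular_poly.
case: Ee => Ee; first by apply: reg_e; rewrite Ee; exact: regularM.
case: n Ee => [|n] Ee; first by apply: reg_e; rewrite Ee expr0 divr1.
have v0 : v != 0 by apply: contraNneq e0 => v0; rewrite Ee v0 mul0r.
have n0 : n.+1%:R != 0 :> E by have /pcharf0P -> := char0.
rewrite (_ : _^-1 = v^-1 * eta (n.+1%:R^-1) *
    (D1 v - (D1 e - eta a / pi) * pi ^+ n.+1 - eta a * pi ^+ n)).
  apply: regularM; first by apply: regularM => //; exact: regular_eta.
  apply: regularB; last by apply: regularM => //; exact: regular_eta.
  by apply: regularB; [exact: regular_D1|exact: regularM].
have pn0 : pi ^+ n != 0 by rewrite expf_neq0.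
rewrite fmorphV rmorph_nat Ee derivation_div ?expf_neq0 // D1pi /=.
rewrite -(mulr_natr (pi ^+ n)) [pi ^+ n.+1]exprS.
move: (pi ^+ n) pn0 (n.+1%:R : E) n0 (D1 v) (eta a) => y y0 N N0 v' b.
by field; rewrite v0 p0 y0 N0.
Qed.

(** The terms of order at least two of a principal part are derivatives. *)
Lemma principal_part (a : nat -> F) n : (0 < n)%N ->
  exists T, \sum_(i < n) eta (a i) / pi ^+ i.+1 = D1 T + eta (a 0) / pi.
Proof.
case: n => // n _; elim: n => [|n [T IH]].
  by exists 0; rewrite big_ord1 derivation0 // add0r expr1.
exists (T - eta (a n.+1 / n.+1%:R) / pi ^+ n.+1); rewrite big_ord_recr /= IH.
have n0 : n.+1%:R != 0 :> E by have /pcharf0P -> := char0.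
rewrite (derivationB derD1) (derivation_div derD1) ?expf_neq0 ?pi_neq0 // D1eta D1pi fmorph_div rmorph_nat /=.
rewrite -(mulr_natr (pi ^+ n)) ![pi ^+ _.+1]exprS mul0r.
have pn0 : pi ^+ n != 0 by rewrite expf_neq0 ?pi_neq0.
move: (pi ^+ n) pn0 (n.+1%:R : E) n0 (eta (a n.+1)) => y y0 N N0 b.
by field; rewrite N0 y0 pi_neq0.
Qed.

(** The assumption of [limit_der_proportional] on [f]: up to derivatives and
    regular terms [n f] is a simple pole, which is neither a derivative nor
    regular, whereas [D2 q0 / q0] is regular. *)
Lemma residue_obstruction f T a w : f = D1 T + eta a / pi + w -> a != 0 -> regular w ->
  forall (n : nat) (q q0 : E), (0 < n)%N -> q0 != 0 -> D2 q0 != (D1 q - f *+ n) * q0.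
Proof.
move=> Ef a0 rw n q q0 n0 q0_neq0; apply/eqP => E0.
have nF : n%:R != 0 :> E by have /pcharf0P -> := char0; rewrite -lt0n.
apply: (@D1_residue (q - T *+ n) (a *+ n)).
  by rewrite -(fmorph_eq0 eta) rmorphMn -(mulr_natr (eta a)) mulf_neq0 ?fmorph_eq0.
rewrite (_ : _ - _ = D2 q0 / q0 + w *+ n).
  apply: regularD; first exact: regular_logder.
  by rewrite -(mulr_natr w); apply: regularM => //; exact: regular_nat.
rewrite E0 mulfK // derivationB // derivationMn // Ef !mulrnDl rmorphMn.
rewrite -(mulr_natr (D1 T)) -(mulr_natr w) -(mulr_natr (eta a)) -(mulr_natr (eta a / pi)).
by field; rewrite pi_neq0.
Qed.

(** Again by [der_proportional_dvdp]: a polynomial that divides its derivative is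
    a scalar. *)
Lemma D1_constant e : D1 e = 0 -> exists a, e = eta a.
Proof.
have charF : [pchar F] =i pred0 by move=> r; rewrite -(fmorph_pchar eta) char0.
have deriv_eq0 (p : {poly F}) : p %| p^`() -> exists a, p = a%:P.
  have [->|p0 dvd_p] := eqVneq p 0; first by exists 0.
  have p'0 : p^`() = 0.
    apply/eqP; apply: contraTT dvd_p => p'0; apply/negP => /(dvdp_leq p'0).
    by rewrite leqNgt lt_size_deriv.
  exists p`_0; apply: size1_polyC; apply/leq_sizeP => -[//|i] _.
  have /eqP := congr1 (fun r : {poly F} => r`_i) p'0.
  rewrite coef_deriv coef0 -mulr_natr mulf_eq0 => /orP[/eqP //|].
  by have /pcharf0P -> := charF.
have [p [q [q0 ->]]] := genx e.
have q_neq0 : q != 0 by apply: contraNneq q0 => ->; rewrite rmorph0 horner0.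
move/(derivation_div_eq0 derD1 _ q0); rewrite !D1ev -!evM => Epq.
have {}Epq : p^`() * q = p * q^`().
  by apply/eqP; rewrite -subr_eq0; apply/eqP/trx; rewrite evD evN Epq subrr.
have der : is_derivation (@deriv F) by split; [exact: derivD|exact: derivM].
have [p1 [q1 [g [Ep Eq _]]]] := der_proportional_dvdp der q_neq0 Epq.
move=> /deriv_eq0 [a Ea] /deriv_eq0 [b Eb]; exists (a / b).
have b0 : b != 0 by apply: contraNneq q_neq0 => b0; rewrite Eq Eb b0 mul0r.
have g0 : ev g != 0.
  by apply: ev_neq0; apply: contraNneq q_neq0 => g0; rewrite Eq g0 mulr0.
rewrite Ep Eq !evM Ea Eb !evC fmorph_div; field.
by rewrite g0 fmorph_eq0 b0.
Qed.

End Residue.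

(** * Constants of the limit equation *)

Lemma derivation_horner (A : fieldType) (d : A -> A) : is_derivation d ->
  forall p z, d p.[z] = (coefwise d p).[z] + p^`().[z] * d z.
Proof.
move=> derd p z; have dercw := coefwise_derivation derd.
elim/poly_ind: p => [|p c IH].
  by rewrite deriv0 !horner0 mul0r addr0 (derivation0 dercw) horner0 derivation0.
rewrite !hornerE derivationD // derivationM // IH.
rewrite (derivationD dercw) (derivationM dercw) coefwiseC // coefwiseX // mulr0 addr0.
rewrite derivD derivC derivM derivX !hornerE; ring.
Qed.

(** This makes the decomposition [d e = e1 * u + e2] below unique. *)
Lemma derivation_unique_extension (U : fieldType) (E : set U) (u e1 e2 : U) :
  is_subfield E -> ~ algebraic_over E u -> E e1 -> E e2 ->
  e1 * u + e2 = 0 -> e1 = 0 /\ e2 = 0.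
Proof.
move=> subE tru Ee1 Ee2 E0.
have [e10|e10] := eqVneq e1 0; first by move: E0; rewrite e10 mul0r add0r.
case: tru; apply: algebraic_over_id => //.
rewrite (_ : u = - e2 / e1); first by apply: subfield_div => //; exact: subfieldN.
apply: (mulfI e10); rewrite mulrCA divff // mulr1.
by apply/eqP; rewrite -addr_eq0 E0.
Qed.

Section LimitEquation.
Variables (U : fieldType) (d : U -> U) (derd : is_derivation d).
Hypothesis char0 : [pchar U] =i pred0.
Variables (F : set U) (dsubF : is_diff_subfield d F) (x : U).
Let u := d x.
Hypothesis indep_xu : alg_independent F (fun i : 'I_2 => pair_fun x u i).
Variables (c : U) (a : {poly U}) (v w : {poly U}).
Hypotheses (Fc : F c) (dc : d c = 0) (Fa : forall i, F a`_i) (Fv : forall i, F v`_i)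
  (Fw : forall i, F w`_i).
Hypotheses (a0 : a`_0 != 0) (wc : w.[c] != 0).
Let f := \sum_(i < size a) a`_i / (x - c) ^+ i.+1 + v.[x] / w.[x].
Hypothesis eq_xu : d u = - f * u.

(** When [f] has the nonzero residue [a`_0] at the constant [c], the equation
    [x'' = - f(x) x'] creates no constant: a constant of [F(x, x')] is the
    quotient of two polynomials in [x'] over [F(x)] that divide their own
    derivatives, and these are monomials by [darboux_monomial]. *)
Lemma limit_equation_constants e :
  field_gen (F `|` [set x; u]) e -> d e = 0 -> F e.
Proof.
have [subF dF] := dsubF; have [trx tru] := (independent2P subF x u).1 indep_xu.
set E0 := field_gen (F `|` [set x]) in tru.
have subE0 : is_subfield E0 by exact: field_gen_subfield.
have E0F y : F y -> E0 y by move=> Fy; apply: sub_field_gen; left.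
have E0x : E0 x by apply: sub_field_gen; right.
have [E [eps EE0]] := subfield_typeP subE0.
have Eeps z : E0 (eps z) by rewrite EE0; exists z.
have lift z : E0 z -> exists y, eps y = z by rewrite EE0 => -[y _ <-]; exists y.
have uniq z1 z2 y1 y2 : eps z1 * u + eps z2 = eps y1 * u + eps y2 -> z1 = y1 /\ z2 = y2.
  move/eqP; rewrite -subr_eq0 => /eqP Ezy.
  have [|||E1 E2] := derivation_unique_extension subE0 tru (e1 := eps (z1 - y1)) (e2 := eps (z2 - y2)).
  - exact: Eeps.
  - exact: Eeps.
  - by rewrite -Ezy !rmorphB; ring.
  by split; apply/eqP; rewrite -subr_eq0 -(fmorph_eq0 eps) ?E1 ?E2 eqxx.
(* The elements with such a decomposition form a field that contains [F] and [x]. *)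
have dE0 z : E0 z -> exists z1 z2, [/\ E0 z1, E0 z2 & d z = z1 * u + z2].
  have z0 := subfield0 subE0; have z1 := subfield1 subE0.
  pose L := [set z | E0 z /\ exists z1 z2, [/\ E0 z1, E0 z2 & d z = z1 * u + z2]].
  suff subL : is_subfield L.
    move=> E0z; have LE : E0 `<=` L.
      apply: field_gen_min => // y [Fy|->].
        split; first exact: E0F.
        exists 0, (d y); split=> //; last by rewrite mul0r add0r.
        by apply: E0F; exact: dF.
      by split=> //; exists 1, 0; split=> //; rewrite mul1r addr0.
    by have [] := LE z E0z.
  split=> [|y1 y2 [E1 [r1 [s1 [Er1 Es1 Ed1]]]] [E2 [r2 [s2 [Er2 Es2 Ed2]]]]
           |y1 y2 [E1 [r1 [s1 [Er1 Es1 Ed1]]]] [E2 [r2 [s2 [Er2 Es2 Ed2]]]]].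
  - by split=> //; exists 0, 0; split=> //; rewrite derivation1 // mul0r addr0.
  - split; first exact: (subfieldB subE0).
    exists (r1 - r2), (s1 - s2); split; [exact: (subfieldB subE0)|exact: (subfieldB subE0)|].
    by rewrite derivationB // Ed1 Ed2; ring.
  - split; first exact: (subfield_div subE0).
    have [->|y20] := eqVneq y2 0.
      by exists 0, 0; rewrite invr0 mulr0 derivation0 // mul0r addr0.
    exists ((r1 * y2 - y1 * r2) / y2 ^+ 2), ((s1 * y2 - y1 * s2) / y2 ^+ 2).
    have y2X : E0 (y2 ^+ 2) by exact: (subfieldX subE0).
    split; try by apply: (subfield_div subE0) => //;
      apply: (subfieldB subE0); exact: (subfieldM subE0).
    by rewrite derivation_div // Ed1 Ed2; field.
have /choice [D12 ED12] : forall z : E, exists y : E * E, d (eps z) = eps y.1 * u + eps y.2.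
  move=> z; have [z1 [z2 [/lift [y1 <-] /lift [y2 <-] Ez]]] := dE0 _ (Eeps z).
  by exists (y1, y2).
pose D1 z := (D12 z).1; pose D2 z := (D12 z).2.
have Ed z : d (eps z) = eps (D1 z) * u + eps (D2 z) by exact: ED12.
have D12D z y : D1 (z + y) = D1 z + D1 y /\ D2 (z + y) = D2 z + D2 y.
  by apply: uniq; rewrite -Ed !rmorphD derivationD // !Ed; ring.
have D12M z y : D1 (z * y) = D1 z * y + z * D1 y /\ D2 (z * y) = D2 z * y + z * D2 y.
  by apply: uniq; rewrite -Ed !rmorphD !rmorphM derivationM // !Ed; ring.
have derD1 : is_derivation D1.
  by split=> z y; [have [] := D12D z y|have [] := D12M z y].
have derD2 : is_derivation D2.
  by split=> z y; [have [] := D12D z y|have [] := D12M z y].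
have subFE : is_subfield [set z | F (eps z)].
  split=> [|z y|z y] /=; first by rewrite rmorph1; exact: (subfield1 subF).
    by rewrite rmorphB; exact: (subfieldB subF).
  by rewrite fmorph_div; exact: (subfield_div subF).
have [FT [eta EF]] := subfield_typeP subFE.
have Feta y : F (eps (eta y)) by rewrite -[F _]/([set z | F (eps z)] _) EF; exists y.
have liftF z : F z -> exists y, eps (eta y) = z.
  move=> Fz; have [z' Ez'] := lift _ (E0F _ Fz).
  have : [set z | F (eps z)] z' by rewrite /= Ez'.
  by rewrite EF => -[y _ Ey]; exists y; rewrite Ey.
have /choice [dFT EdFT] : forall y, exists y', eps (eta y') = d (eps (eta y)).
  by move=> y; apply: liftF; apply: dF.
have Deta y : D1 (eta y) = 0 /\ D2 (eta y) = eta (dFT y).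
  by apply: uniq; rewrite -Ed -EdFT rmorph0 mul0r add0r.
have [xE Ex] := lift _ E0x.
have Dx : D1 xE = 1 /\ D2 xE = 0.
  by apply: uniq; rewrite -Ed Ex rmorph1 rmorph0 mul1r addr0.
have eps_horner (p : {poly FT}) :
    eps (map_poly eta p).[xE] = (map_poly (eps \o eta) p).[x].
  by rewrite map_poly_comp -Ex horner_map.
have trxE (p : {poly FT}) : (map_poly eta p).[xE] = 0 -> p = 0.
  move=> /(congr1 eps); rewrite eps_horner rmorph0 => px.
  apply: contra_notP trx => /eqP p0; exists (map_poly (eps \o eta) p).
  by rewrite map_poly_eq0 p0; split=> // [i|]; [rewrite coef_map; exact: Feta|exact/rootP].
have rangeF : range (eps \o eta) = F.
  by apply/seteqP; split=> [_ [y _ <-]|z /liftF [y <-]]; [exact: Feta|exists y].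
have genE (z : E) : exists p q : {poly FT},
    (map_poly eta q).[xE] != 0 /\ z = (map_poly eta p).[xE] / (map_poly eta q).[xE].
  have : field_gen (range (eps \o eta) `|` [set x]) (eps z) by rewrite rangeF; exact: Eeps.
  move=> /adjoin1P [p [q [q0 Ez]]]; exists p, q; split.
    by rewrite -(fmorph_eq0 eps) eps_horner.
  by apply: (fmorph_inj eps); rewrite fmorph_div !eps_horner.
have charE : [pchar E] =i pred0 by move=> r; rewrite -(fmorph_pchar eps) char0.
have [cE Ec] := liftF _ Fc.
have D2c : D2 (eta cE) = 0.
  by apply: (uniq (D1 (eta cE)) _ 0 0 _).2; rewrite -Ed Ec dc rmorph0 mul0r addr0.
have lift_polyF (p : {poly U}) : (forall i, F p`_i) ->
    exists q : {poly FT}, map_poly (eps \o eta) q = p.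
  by move=> Fp; apply: lift_poly => i; rewrite rangeF.
have [aE EaE] := lift_polyF a Fa; have [vE EvE] := lift_polyF v Fv.
have [wE EwE] := lift_polyF w Fw.
have EaEi i : eps (eta aE`_i) = a`_i by rewrite -EaE coef_map.
have aE0 : aE`_0 != 0 by rewrite -(fmorph_eq0 eta) -(fmorph_eq0 eps) EaEi.
have wEc : wE.[cE] != 0.
  by rewrite -(fmorph_eq0 (eps \o eta)) -horner_map /= EwE Ec.
have szaE : (0 < size aE)%N.
  by rewrite size_poly_gt0; apply: contraNneq aE0 => ->; rewrite coef0.
have [T ET] := principal_part trxE derD1 (fun y => (Deta y).1) Dx.1 charE cE (fun i => aE`_i) szaE.
pose fE := \sum_(i < size aE) eta aE`_i / (xE - eta cE) ^+ i.+1
  + (map_poly eta vE).[xE] / (map_poly eta wE).[xE].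
have EfE : eps fE = f.
  rewrite /fE rmorphD rmorph_sum fmorph_div !eps_horner EvE EwE; congr (_ + _).
  rewrite -[in RHS]EaE size_map_poly; apply: eq_bigr => i _.
  by rewrite fmorph_div rmorphXn rmorphB /= EaE EaEi Ex Ec.
have Deta1 y := (Deta y).1; have Deta2 y := (Deta y).2; have [Dx1 Dx2] := Dx.
(* [E] is the rational function field over [FT] in [xE], with [D1] the derivation
   with respect to [xE] and [D2] the one that extends [d] by [D2 xE = 0]. *)
have res_fE := residue_obstruction trxE genE derD1 derD2 Deta1 Dx1 Deta2 Dx2 charE D2c
  (congr1 (+%R^~ _) ET : fE = _) aE0 (ex_intro _ vE (ex_intro _ wE (conj wEc erefl))).
have tr_u (p : {poly E}) : (map_poly eps p).[u] = 0 -> p = 0.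
  move=> pu; apply: contra_notP tru => /eqP p0; exists (map_poly eps p).
  by rewrite map_poly_eq0 p0; split=> // [i|]; [rewrite coef_map; exact: Eeps|exact/rootP].
have d_horner (p : {poly E}) :
    d (map_poly eps p).[u] = (map_poly eps (limit_der D1 D2 fE p)).[u].
  rewrite derivation_horner // eq_xu -EfE /limit_der; set g := eps fE.
  have -> : coefwise d (map_poly eps p) =
      map_poly eps (coefwise D1 p) * u%:P + map_poly eps (coefwise D2 p).
    by apply/polyP=> i; rewrite coefD coefMC !(coef_coefwise, coef_map) ?Ed.
  rewrite deriv_map !(rmorphB, rmorphD, rmorphM, map_polyX, map_polyZ) /=.
  rewrite ?(rmorphM, map_polyX, map_polyZ) /= ?map_polyX -/g.
  by rewrite !(hornerD, hornerN, hornerM, hornerZ, hornerC, hornerX); ring.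
move=> Fe de0.
have {Fe} : field_gen (range eps `|` [set u]) e.
  apply: field_gen_min Fe; first exact: field_gen_subfield.
  move=> y [Fy|[->|->]]; apply: sub_field_gen; [left|left|by right]; rewrite -EE0 //.
  exact: E0F.
move=> /adjoin1P [P [Q [Q0 Ee]]].
have Q_neq0 : Q != 0 by apply: contraNneq Q0 => ->; rewrite rmorph0 horner0.
have [b EP] : exists b, P = b *: Q.
  apply: (limit_der_proportional derD1 derD2 _ Q_neq0 (f := fE)).
    by move=> n q q0; exact: res_fE.
  apply/eqP; rewrite -subr_eq0; apply/eqP/tr_u.
  rewrite rmorphB !rmorphM hornerD hornerN !hornerM -!d_horner.
  by apply/eqP; rewrite subr_eq0; apply/eqP/(derivation_div_eq0 derd _ Q0); rewrite -Ee.
have {}Ee : e = eps b by rewrite Ee EP map_polyZ hornerZ mulfK.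
have D1b : D1 b = 0.
  by apply: (uniq _ (D2 b) 0 0 _).1; rewrite -Ed -Ee de0 rmorph0 mul0r addr0.
have [y Ey] := D1_constant trxE genE derD1 Deta1 Dx1 charE D1b.
by rewrite Ee Ey.
Qed.
End LimitEquation.

(** * Generic solutions from saturation *)

Section Small.
Variable U : fieldType.
Hypothesis char0 : [pchar U] =i pred0.
Implicit Types A B : set U.

Lemma card_le_injP (T : Type) (A : set T) B :
  (A #<= B)%card <-> exists2 f : T -> U, set_fun A B f & set_inj A f.
Proof.
pose Up : pointedType := HB.pack (U : Type) (Choice.class U) (isPointed.Build U 0).
split=> [le_AB|ex_f]; last exact/(@pcard_leP T Up A B)/injfunPex.
by have /(@pcard_leP T Up A B)/injfunPex := le_AB.
Qed.

Lemma nat_inj : injective (fun n : nat => n%:R : U).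
Proof.
suff le_inj m n : (m <= n)%N -> m%:R = n%:R :> U -> m = n.
  by move=> m n /=; case/orP: (leq_total m n) => /le_inj h E; [apply: h|apply/esym/h].
move=> le_mn /esym/eqP; rewrite -subr_eq0 -natrB //.
have /pcharf0P -> := char0; rewrite subn_eq0 => le_nm.
by apply/eqP; rewrite eqn_leq le_mn.
Qed.

Lemma small_finite A : finite_set A -> small A.
Proof.
move=> finA leUA; have /finite_setPn := card_le_finite leUA finA; apply.
by apply/card_le_injP; exists (fun n => n%:R) => // m n _ _; exact: nat_inj.
Qed.

(** An infinite set can absorb one more element: shift a sequence in it. *)
Lemma small_setU1 A b : small A -> small (A `|` [set b]).
Proof.
move=> sA; have [finA|infA] := pselect (finite_set A).
  by apply: small_finite; rewrite finite_setU; split=> //; exact: finite_set1.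
have [Ab|nAb] := pselect (A b).
  by rewrite (_ : _ `|` _ = A) //; apply/seteqP; split=> [x [//|->]|x Ax]; [|left].
have /infiniteP/card_le_injP [g gA g_inj] := infA.
have {}g_inj : injective g by move=> m n; apply: g_inj; rewrite in_setT.
pose sh y := if pselect (exists n, g n = y) is left h then g (sval (cid h)).+1
             else if y == b then g 0 else y.
have sh_g n : sh (g n) = g n.+1.
  rewrite /sh; case: pselect => [h|[]]; last by exists n.
  by case: (cid h) => m /= /g_inj ->.
have sh_b : sh b = g 0.
  by rewrite /sh; case: pselect => [[n gn]|_]; [case: nAb; rewrite -gn; exact: gA|rewrite eqxx].
have sh_o y : A y -> (forall n, g n <> y) -> sh y = y.
  move=> Ay ny; rewrite /sh; case: pselect => [[n gn]|_]; first by case: (ny n).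
  by case: eqP => // Ey; case: nAb; rewrite -Ey.
have shP y : (A `|` [set b]) y ->
    [\/ exists2 n, y = g n & sh y = g n.+1, y = b /\ sh y = g 0 |
      [/\ A y, forall n, g n <> y & sh y = y]].
  move=> [Ay|->]; last by constructor 2.
  have [[n <-]|ny] := pselect (exists n, g n = y); first by constructor 1; exists n.
  have {}ny n : g n <> y by move=> gn; apply: ny; exists n.
  by constructor 3; split=> //; exact: sh_o.
move=> /card_le_injP [h hA h_inj]; apply: sA; apply/card_le_injP.
exists (sh \o h) => [y _|y y' _ _ /= Esh].
  have [] := shP (h y) (hA y I).
  - by move=> [n _ E]; rewrite /= E; exact: gA.
  - by move=> [_ E]; rewrite /= E; exact: gA.
  - by move=> [Ay _ E]; rewrite /= E.
apply: h_inj; rewrite ?in_setT //.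
have [] := shP (h y) (hA y I); have [] := shP (h y') (hA y' I).
- by move=> [n E1 En] [m E2 Em]; move: Esh; rewrite En Em E1 E2 => /g_inj [->].
- by move=> [_ E0] [m _ Em]; move: Esh; rewrite E0 Em => /g_inj.
- by move=> [_ ny E0] [m _ Em]; move: Esh; rewrite E0 Em => /ny.
- by move=> [n _ En] [_ E0]; move: Esh; rewrite En E0 => /g_inj.
- by move=> [-> _] [->].
- by move=> [_ ny E] [_ E0]; move: Esh; rewrite E E0 => /ny.
- by move=> [n _ En] [_ ny E]; move: Esh; rewrite E En => /esym/ny.
- by move=> [_ E0] [_ ny E]; move: Esh; rewrite E E0 => /esym/ny.
- by move=> [_ _ E] [_ _ E']; move: Esh; rewrite E E'.
Qed.

End Small.

Section Terms.
Variables (U : fieldType) (d : U -> U) (derd : is_derivation d).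
Hypothesis char0 : [pchar U] =i pred0.
Variable A : set U.

(** The functions that quantifier-free formulas over [A] can speak about. *)
Definition term_fun (h : U -> U) : Prop :=
  exists2 t : dterm U unit, dterm_over A t & forall x, deval d (fun _ => x) t = h x.

Lemma term_fun_id : term_fun id.
Proof. by exists (DVar U tt). Qed.

Lemma term_fun_param a : A a -> term_fun (fun _ => a).
Proof. by move=> Aa; exists (DParam unit a). Qed.

Lemma term_fun0 : term_fun (fun _ => 0).
Proof. by exists (DZero U unit). Qed.

Lemma term_fun1 : term_fun (fun _ => 1).
Proof. by exists (DOne U unit). Qed.

Lemma term_funD h1 h2 : term_fun h1 -> term_fun h2 -> term_fun (fun x => h1 x + h2 x).
Proof.
by move=> [t1 A1 E1] [t2 A2 E2]; exists (DAdd t1 t2) => //= x; rewrite E1 E2.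
Qed.

Lemma term_funN h : term_fun h -> term_fun (fun x => - h x).
Proof. by move=> [t At Et]; exists (DOpp t) => //= x; rewrite Et. Qed.

Lemma term_funM h1 h2 : term_fun h1 -> term_fun h2 -> term_fun (fun x => h1 x * h2 x).
Proof.
by move=> [t1 A1 E1] [t2 A2 E2]; exists (DMul t1 t2) => //= x; rewrite E1 E2.
Qed.

Lemma term_fun_der h : term_fun h -> term_fun (fun x => d (h x)).
Proof. by move=> [t At Et]; exists (DDer t) => //= x; rewrite Et. Qed.

Lemma eq_term_fun h1 h2 : h1 =1 h2 -> term_fun h1 -> term_fun h2.
Proof. by move=> E [t At Et]; exists t => // x; rewrite Et. Qed.

Lemma term_fun_sum (I : Type) (r : seq I) (h : I -> U -> U) :
  (forall i, term_fun (h i)) -> term_fun (fun x => \sum_(i <- r) h i x).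
Proof.
move=> th; elim: r => [|i r IH].
  by apply: eq_term_fun term_fun0 => x; rewrite big_nil.
by apply: eq_term_fun (term_funD (th i) IH) => x; rewrite big_cons.
Qed.

Lemma term_fun_prod (I : Type) (r : seq I) (h : I -> U -> U) :
  (forall i, term_fun (h i)) -> term_fun (fun x => \prod_(i <- r) h i x).
Proof.
move=> th; elim: r => [|i r IH].
  by apply: eq_term_fun term_fun1 => x; rewrite big_nil.
by apply: eq_term_fun (term_funM (th i) IH) => x; rewrite big_cons.
Qed.

Lemma term_funX h n : term_fun h -> term_fun (fun x => h x ^+ n).
Proof.
move=> th; elim: n => [|n IH].
  by apply: eq_term_fun term_fun1 => x; rewrite expr0.
by apply: eq_term_fun (term_funM th IH) => x; rewrite exprS.
Qed.

(** The values of closed terms over [A]: the differential ring generated by [A]. *)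
Definition term_values : set U := [set b | term_fun (fun _ => b)].

Lemma term_values1 : term_values 1. Proof. exact: term_fun1. Qed.

Lemma term_valuesB x y : term_values x -> term_values y -> term_values (x - y).
Proof. by move=> tx ty; apply: (term_funD tx (term_funN ty)). Qed.

Lemma term_valuesM x y : term_values x -> term_values y -> term_values (x * y).
Proof. exact: term_funM. Qed.

Lemma term_fun_mpoly n (G : {mpoly U[n]}) : (forall m, term_values G@_m) ->
  term_fun (fun x => G.@[fun i => iter i d x]).
Proof.
move=> tG; apply: (@eq_term_fun (fun x => \sum_(m <- msupp G) G@_m *
    \prod_(i <- index_enum 'I_n) iter i d x ^+ m i)); first by move=> x; rewrite mevalE.
apply: term_fun_sum => m; apply: term_funM; first exact: tG.
apply: term_fun_prod => i; apply: term_funX.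
by elim: (i : nat) => [|j IH] /=; [exact: term_fun_id|exact: term_fun_der].
Qed.

Lemma term_fun_horner (p : {poly U}) h : (forall i, term_values p`_i) ->
  term_fun h -> term_fun (fun x => p.[h x]).
Proof.
move=> tp th; apply: (@eq_term_fun (fun x => \sum_(i <- index_enum 'I_(size p)) p`_i * h x ^+ i)).
  by move=> x; rewrite horner_coef.
by apply: term_fun_sum => i; apply: term_funM (tp i) (term_funX _ th).
Qed.

(** Thus conditions over the differential field generated by [A] are, up to
    clearing denominators, conditions over [A], whose smallness is what
    saturation asks for. *)
Lemma diff_field_gen_fractions : diff_field_gen d A `<=` fractions term_values.
Proof.
have t1 := term_values1; have tB := term_valuesB; have tM := term_valuesM.
apply: diff_field_gen_min; last first.
  by move=> a Aa; apply: sub_fractions => //; exact: term_fun_param.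
split; first exact: fractions_subfield.
move=> _ [a [b [Sa Sb b0 ->]]]; exists (d a * b - a * d b), (b ^+ 2).
split; [|by rewrite expr2; exact: tM|by rewrite expf_neq0|by rewrite derivation_div].
by apply: tB; apply: tM => //; exact: term_fun_der.
Qed.

End Terms.

Lemma exists_nonroot (U : fieldType) (p : {poly U}) : [pchar U] =i pred0 -> p != 0 ->
  exists x, p.[x] != 0.
Proof.
move=> char0 p0; apply: contrapT => all_roots.
have : (size [seq i%:R : U | i <- iota 0 (size p)] < size p)%N.
  apply: max_poly_roots => //; last by rewrite map_inj_uniq ?iota_uniq //; exact: nat_inj.
  by apply/allP => x _; apply: contrapT => /negP px; apply: all_roots; exists x.
by rewrite size_map size_iota ltnn.
Qed.

Section Saturation.
Variables (U : fieldType) (d : U -> U).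
Hypotheses (dcfU : is_DCF0 d) (satU : saturated d).

Lemma DCF0_derivation : is_derivation d.
Proof. by case: dcfU => _ dD dM _; split. Qed.

Lemma DCF0_char0 : [pchar U] =i pred0. Proof. by case: dcfU. Qed.

(** Saturation and Blum's axiom provide, over any small set [A], a solution of a
    second-order equation [W(y) y'' + y' N1(y) + N2(y) = 0] that satisfies no
    first-order equation over the differential field generated by [A]. *)
Lemma generic_solution_exists (A : set U) (W N1 N2 : {poly U}) : small A ->
  (forall i, term_values d A W`_i) -> (forall i, term_values d A N1`_i) ->
  (forall i, term_values d A N2`_i) -> W != 0 ->
  exists z, W.[z] * d (d z) + d z * N1.[z] + N2.[z] = 0 /\
    alg_independent (diff_field_gen d A) (fun i : 'I_2 => pair_fun z (d z) i).
Proof.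
move=> sA tW tN1 tN2 W0; have derd := DCF0_derivation.
pose ode z := W.[z] * d (d z) + d z * N1.[z] + N2.[z].
pose jet (z : U) : 'I_2 -> U := fun i => iter i d z.
have jetE z : jet z = fun i : 'I_2 => pair_fun z (d z) i.
  by apply: funext => -[[|[|//]] lt_i].
pose good (phi : dformula U unit) (G : {mpoly U[2]}) := forall z, dholds d phi (fun _ => z) <-> G.@[jet z] != 0.
pose q : set (dformula U unit) := [set phi | dformula_over A phi /\
  ((forall z, dholds d phi (fun _ => z) <-> ode z = 0) \/ exists2 G, G != 0 & good phi G)].
have [||z qz] := satU sA (q := q); first by move=> phi [].
  move=> q0 /finite_set_leP [n le_n] q0q.
  have [f fA f_inj] : exists2 f : dformula U unit -> nat, set_fun q0 `I_n f & set_inj q0 f.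
    by have /pcard_leP/injfunPex := le_n.
  have /choice [G GP] : forall i, exists G : {mpoly U[2]}, G != 0 /\
      forall phi, q0 phi -> f phi = i -> (forall z, dholds d phi (fun _ => z) <-> ode z = 0) \/ good phi G.
    move=> i; have [[phi [q0phi fphi]]|nphi] := pselect (exists phi, q0 phi /\ f phi = i); last first.
      by exists 1; rewrite oner_neq0; split=> // phi q0phi fphi; case: nphi; exists phi.
    have uniq phi' : q0 phi' -> f phi' = i -> phi' = phi.
      by move=> q0phi' fphi'; apply: f_inj; rewrite ?in_setE // fphi fphi'.
    have [_ [h|[G G0 h]]] := q0q _ q0phi.
      by exists 1; rewrite oner_neq0; split=> // phi' q1 /(uniq _ q1) ->; left.
    by exists G; split=> // phi' q1 /(uniq _ q1) ->; right.
  pose eqn : {mpoly U[3]} :=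
    (map_poly (@mpolyC 3 U) W).['X_ord0] * 'X_ord_max
    + 'X_(inord 1) * (map_poly (@mpolyC 3 U) N1).['X_ord0] + (map_poly (@mpolyC 3 U) N2).['X_ord0].
  have ev_horner (p : {poly U}) (v : 'I_3 -> U) i :
      (map_poly (@mpolyC 3 U) p).['X_i].@[v] = p.[v i].
    rewrite -[X in X.@[v]]/((_).['X_i]) -(horner_map (meval v)) /= mevalXU -map_poly_comp.
    by rewrite map_poly_id // => c _ /=; rewrite mevalC.
  have ev_eqn z : eqn.@[fun i => iter i d z] = ode z.
    by rewrite /eqn !mevalD !mevalM !ev_horner !mevalXU /= inordK.
  (* Otherwise the value of [eqn] would not depend on the third variable, but it
     does where [W] does not vanish. *)
  have eqn_top : exists2 m, m \in msupp eqn & m ord_max != 0%N.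
    apply: contrapT => no_top.
    have [x0 Wx0] := exists_nonroot DCF0_char0 W0.
    pose v (y : U) (i : 'I_3) : U := nth 0 [:: x0; 0; y] i.
    have Ev y : eqn.@[v y] = W.[x0] * y + N2.[x0].
      rewrite /eqn !mevalD !mevalM !ev_horner !mevalXU /v /=.
      by rewrite inordK // mul0r addr0.
    case/eqP: Wx0; apply: (addIr N2.[x0]); rewrite add0r.
    rewrite -[X in X + _]mulr1 -Ev -[RHS]add0r -[X in X + _](mulr0 W.[x0]) -Ev !mevalE.
    apply: eq_big_seq => m mG; congr (_ * _); apply: eq_bigr => i _.
    have [->|ne_i] := eqVneq i ord_max; last first.
      congr (_ ^+ _); rewrite /v; case: i ne_i => -[|[|[|//]]] lt_i //= /eqP[].
    suff -> : m ord_max = 0%N by rewrite !expr0.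
    by apply/eqP; apply: contrapT => /negP m0; apply: no_top; exists m.
  have prod0 : \prod_(i < n) G i != 0 by apply/prodf_neq0 => i _; have [] := GP i.
  have [char0 _ _ /(_ 2 eqn _ eqn_top prod0) [z [eqz Gz]]] := dcfU.
  exists z => phi q0phi; have [_ GPphi] := GP (f phi).
  have [->|good_phi] := GPphi phi q0phi erefl; first by rewrite -ev_eqn.
  apply/good_phi; apply: contraNneq Gz => E0; rewrite rmorph_prod.
  have lt_fn : (f phi < n)%N by exact: fA.
  by rewrite (bigD1 (Ordinal lt_fn)) //= E0 mul0r.
exists z; split.
  have [t At Et] : term_fun d A ode.
    apply: term_funD; [apply: term_funD; apply: term_funM|];
      try by apply: term_fun_horner => //; exact: term_fun_id.
      by do 2!apply: term_fun_der; exact: term_fun_id.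
    by apply: term_fun_der; exact: term_fun_id.
  have := qz (DEq t (DZero U unit)); rewrite /= Et; apply; split=> //; left => y.
  by rewrite /= Et.
rewrite -jetE => G DG Gz; apply/eqP; apply: contraT => G0; exfalso.
have t1 := @term_values1 _ d A; have tB := @term_valuesB _ d A; have tM := @term_valuesM _ d A.
have [|b [Sb b0 bP]] := common_denominator t1 tM (r := [seq G@_m | m <- msupp G]).
  by move=> _ /mapP [m _ ->]; apply: diff_field_gen_fractions.
have tbG m : term_values d A (b *: G)@_m.
  rewrite mcoeffZ; have [mG|/memN_msupp_eq0 ->] := boolP (m \in msupp G).
    by apply: bP; apply: map_f.
  by rewrite mulr0; exact: term_fun0.
have [t At Et] := term_fun_mpoly tbG.
have := qz (DNot (DEq t (DZero U unit))); rewrite /= Et -/(jet z) mevalZ Gz mulr0; apply => //.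
split=> //; right; exists G => // y /=; rewrite Et -/(jet y) mevalZ.
split=> [h|Gy /eqP]; last by rewrite mulf_eq0 (negPf b0) (negPf Gy).
by apply: contra_notN h => /eqP ->; rewrite mulr0.
Qed.

End Saturation.

Section Sequences.
Variables (U : fieldType) (d : U -> U).

Lemma term_fun_mono (A B : set U) h : A `<=` B -> term_fun d A h -> term_fun d B h.
Proof.
move=> AB [t At Et]; exists t => //; elim: t At {Et} => //=.
- by move=> t1 IH1 t2 IH2 [/IH1 ? /IH2].
- by move=> t1 IH1 t2 IH2 [/IH1 ? /IH2].
Qed.

Lemma diff_field_gen_mono (A B : set U) : A `<=` B -> diff_field_gen d A `<=` diff_field_gen d B.
Proof.
move=> AB; apply: diff_field_gen_min; first exact: diff_field_gen_diff.
by apply: subset_trans AB _; exact: sub_diff_field_gen.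
Qed.

(** Each [z j] is a solution that is generic over the differential field
    generated by [B j], which contains the previous ones. *)
Definition generic_sequence (A : set U) (W N1 N2 : {poly U}) (B : nat -> set U) (z : nat -> U) :=
  [/\ B 0 = A, forall j, B j.+1 = B j `|` [set z j],
      forall j, W.[z j] * d (d (z j)) + d (z j) * N1.[z j] + N2.[z j] = 0 &
      forall j, alg_independent (diff_field_gen d (B j)) (fun i : 'I_2 => pair_fun (z j) (d (z j)) i)].

Lemma generic_sequence_exists (A : set U) (W N1 N2 : {poly U}) :
  is_DCF0 d -> saturated d -> small A ->
  (forall i, term_values d A W`_i) -> (forall i, term_values d A N1`_i) ->
  (forall i, term_values d A N2`_i) -> W != 0 ->
  exists B z, generic_sequence A W N1 N2 B z.
Proof.
move=> dcfU satU sA tW tN1 tN2 W0.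
have /choice [g gP] : forall B : set U, exists z, small B -> A `<=` B ->
    W.[z] * d (d z) + d z * N1.[z] + N2.[z] = 0 /\
    alg_independent (diff_field_gen d B) (fun i : 'I_2 => pair_fun z (d z) i).
  move=> B; have [[sB AB]|nB] := pselect (small B /\ A `<=` B); last first.
    by exists 0 => sB AB; case: nB.
  have tB (p : {poly U}) : (forall i, term_values d A p`_i) -> forall i, term_values d B p`_i.
    by move=> tp i; apply: term_fun_mono (tp i).
  by have [z zP] := generic_solution_exists dcfU satU sB (tB _ tW) (tB _ tN1) (tB _ tN2) W0; exists z.
pose B j := iter j (fun C => C `|` [set g C]) A.
have BP j : small (B j) /\ A `<=` B j.
  elim: j => [|j [IH1 IH2]] /=; first by split. 
  split; last by move=> x Ax; left; exact: IH2.
  exact: (small_setU1 (DCF0_char0 dcfU)).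
exists B, (g \o B); split=> // j; have [sB AB] := BP j; first exact: (gP _ sB AB).1.
exact: (gP _ sB AB).2.
Qed.

(** The solutions and their derivatives, interleaved. *)
Definition jets (z : nat -> U) (i : nat) : U := iter (odd i) d (z i./2).

Section Generic.
Variables (A : set U) (W N1 N2 : {poly U}) (B : nat -> set U) (z : nat -> U).
Hypothesis gen : generic_sequence A W N1 N2 B z.

Lemma generic_sequence_sub i j : (i <= j)%N -> B i `<=` B j.
Proof.
case: gen => _ BS _ _; elim: j => [|j IH]; first by rewrite leqn0 => /eqP ->.
by rewrite leq_eqVlt => /predU1P[->//|lt_ij] x Bx; rewrite BS; left; exact: IH.
Qed.

Lemma generic_sequence_mem i j : (i < j)%N -> B j (z i).
Proof.
move=> lt_ij; apply: (generic_sequence_sub lt_ij).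
by case: gen => _ -> _ _; right.
Qed.

Lemma generic_sequence_independent (K : set U) n :
  is_subfield K -> K `<=` diff_field_gen d A -> alg_independent K (fun i : 'I_n => jets z i).
Proof.
move=> subK KA; apply: independent_chain => // i _; have [B0 BS _ ind] := gen.
have DP j := diff_field_gen_diff d (B j).
have KD j : K `<=` diff_field_gen d (B j).
  by move=> x /KA; apply: diff_field_gen_mono; rewrite -B0; exact: generic_sequence_sub.
have jetD l j : (l./2 < j)%N -> diff_field_gen d (B j) (jets z l).
  move=> /generic_sequence_mem/(sub_diff_field_gen (d := d)) Dz.
  by rewrite /jets; case: (odd l) => //=; exact: (DP j).2.
have [/(_ _)] := (independent2P (DP i./2).1 _ _).1 (ind i./2).
rewrite /jets; case Ei: (odd i) => /= tr0 tr1.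
  apply: contra_not tr1; apply: algebraic_over_mono.
  apply: field_gen_min; first exact: field_gen_subfield.
  move=> x [/(KD i./2) Kx|[l _ <-]]; apply: sub_field_gen; first by left.
  have := ltn_ord l; rewrite -{2}(odd_double_half i) Ei add1n ltnS leq_eqVlt.
  case/predU1P => [El|lt_l]; first by right; rewrite El odd_double doubleK.
  left; apply: jetD; rewrite -ltn_double; apply: leq_ltn_trans lt_l.
  by rewrite -{2}(odd_double_half l) leq_addl.
apply: contra_not tr0; apply: algebraic_over_mono.
apply: field_gen_min; first exact: (DP _).1.
move=> x [/KD //|[l _ <-]]; apply: jetD.
rewrite -ltn_double; apply: leq_ltn_trans (_ : l < _)%N.
  by rewrite -{2}(odd_double_half l) leq_addl.
by have := ltn_ord l; rewrite -{2}(odd_double_half i) Ei.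
Qed.

End Generic.
End Sequences.

(** * Degeneration of a family of vector fields *)

Section VectorField.
Variables (R : comNzRingType) (n : nat) (vf : 'I_n -> {mpoly R[n]}).

Definition vderiv (G : {mpoly R[n]}) : {mpoly R[n]} := \sum_(i < n) vf i * G^`M(i).

Lemma vderiv_derivation : is_derivation vderiv.
Proof.
split=> G H.
  by rewrite -big_split; apply: eq_bigr => i _; rewrite mderivD mulrDr.
rewrite mulr_suml mulr_sumr -big_split; apply: eq_bigr => i _ /=.
by rewrite mderivM; ring.
Qed.

Lemma vderivZ c G : vderiv (c *: G) = c *: vderiv G.
Proof. by rewrite scaler_sumr; apply: eq_bigr => i _; rewrite mderivZ scalerAr. Qed.

End VectorField.

Lemma map_mpoly_mderiv (R S : comNzRingType) (rho : {rmorphism R -> S}) n (G : {mpoly R[n]}) i :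
  map_mpoly rho G^`M(i) = (map_mpoly rho G)^`M(i).
Proof.
by apply/mpolyP=> m; rewrite mcoeff_map_mpoly /= !mcoeff_mderiv mcoeff_map_mpoly raddfMn.
Qed.

Lemma map_mpoly_vderiv (R S : comNzRingType) (rho : {rmorphism R -> S}) n
    (vf : 'I_n -> {mpoly R[n]}) G :
  map_mpoly rho (vderiv vf G) = vderiv (map_mpoly rho \o vf) (map_mpoly rho G).
Proof.
rewrite /vderiv rmorph_sum; apply: eq_bigr => i _.
by rewrite rmorphM /= map_mpoly_mderiv.
Qed.

Section Degeneration.
Variables (C : fieldType) (n : nat) (vf : 'I_n -> {mpoly {poly C}[n]}).
Local Notation ev0 := (horner_eval (0 : C)).
Let vf0 := map_mpoly ev0 \o vf.

Hypothesis constants0 : forall P Q : {mpoly C[n]}, Q != 0 ->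
  vderiv vf0 P * Q = P * vderiv vf0 Q -> exists a, P = a *: Q.

Lemma mpoly_divX (P : {mpoly {poly C}[n]}) :
  map_mpoly ev0 P = 0 -> exists P', P = 'X *: P'.
Proof.
move=> P0; exists (\sum_(m <- msupp P) (P@_m %/ 'X) *: 'X_[m]).
rewrite [in LHS](mpolyE P) scaler_sumr; apply: eq_bigr => m _.
rewrite scalerA; congr (_ *: _); rewrite mulrC divpK // -['X]subr0 dvdp_XsubCl.
by have := congr1 (mcoeff m) P0; rewrite mcoeff_map_mpoly mcoeff0 rootE => /eqP.
Qed.

(* The minors of [(P, Q)] are divisible by [t^r]: either [t] divides [Q], or [P] is
   congruent modulo [t] to a scalar multiple [a Q] and [(P - a Q) / t] replaces [P]. *)
Let wedge_dvd r : forall (P Q : {mpoly {poly C}[n]}), vderiv vf P * Q = P * vderiv vf Q ->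
  forall m m', 'X^r %| P@_m * Q@_m' - P@_m' * Q@_m.
Proof.
elim: r => [|r IH] P Q PQ m m'; first by rewrite expr0 dvd1p.
have X0 : ('X : {poly C})%:MP_[n] != 0 by rewrite mpolyC_eq0 polyX_eq0.
have [Q0|Q0] := eqVneq (map_mpoly ev0 Q) 0.
  have [Q' EQ] := mpoly_divX Q0.
  rewrite EQ !mcoeffZ mulrCA [P@_m' * _]mulrCA -mulrBr exprS dvdp_mul // IH //.
  apply: (mulIf X0); rewrite -!(mulrC _%:MP) !mul_mpolyC.
  by rewrite !scalerAr -vderivZ -EQ.
have PQ0 := congr1 (map_mpoly ev0) PQ.
rewrite !rmorphM /= !map_mpoly_vderiv in PQ0.
have [a Ea] := constants0 Q0 PQ0.
have [P' EP] : exists P', P - a%:P *: Q = 'X *: P'.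
  by apply: mpoly_divX; rewrite rmorphB /= map_mpolyZ Ea /= horner_evalE hornerC subrr.
have -> : P = a%:P *: Q + 'X *: P' by rewrite -EP; ring.
rewrite !mcoeffD !mcoeffZ.
have -> : (a%:P * Q@_m + 'X * P'@_m) * Q@_m' - (a%:P * Q@_m' + 'X * P'@_m') * Q@_m
  = 'X * (P'@_m * Q@_m' - P'@_m' * Q@_m) by ring.
rewrite exprS dvdp_mul // IH //.
apply: (mulIf X0); rewrite -!(mulrC _%:MP) !mul_mpolyC !scalerAl -vderivZ -EP.
have der := vderiv_derivation vf.
by rewrite (derivationB der) vderivZ !mulrBl PQ -!scalerAl (mulrC Q).
Qed.

(** If the constants of the special member [t = 0] of a family of vector fields
    over [C[t]] are trivial, then so are those of the family: a constant fraction
    [P / Q] is successively reduced modulo [t], so that it agrees modulo every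
    power of [t] with a fraction of scalars. *)
Lemma constants_degeneration (P Q : {mpoly {poly C}[n]}) :
  vderiv vf P * Q = P * vderiv vf Q -> forall m m', P@_m * Q@_m' = P@_m' * Q@_m.
Proof.
move=> PQ m m'; apply/eqP; rewrite -subr_eq0; apply: contraT => ne0.
have := dvdp_leq ne0 (wedge_dvd (size (P@_m * Q@_m' - P@_m' * Q@_m)) PQ m m').
by rewrite size_polyXn ltnn.
Qed.

End Degeneration.

Lemma constants_specialization (R : comNzRingType) (C : fieldType) n
    (seg : {rmorphism R -> {poly C}}) (vf : 'I_n -> {mpoly R[n]}) (vf0 : 'I_n -> {mpoly C[n]}) :
  (forall i, map_mpoly (horner_eval 0) (map_mpoly seg (vf i)) = vf0 i) ->
  (forall P Q : {mpoly C[n]}, Q != 0 -> vderiv vf0 P * Q = P * vderiv vf0 Q ->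
     exists a, P = a *: Q) ->
  forall G H, vderiv vf G * H = G * vderiv vf H ->
  forall l l', seg G@_l * seg H@_l' = seg G@_l' * seg H@_l.
Proof.
move=> Evf0 const0 G H GH l l'.
have segM : {morph @map_mpoly n _ _ seg : x y / x * y} by exact: rmorphM.
have {}GH := congr1 (map_mpoly seg) GH.
rewrite !segM !map_mpoly_vderiv in GH.
have := constants_degeneration _ GH l l'; rewrite !mcoeff_map_mpoly; apply.
move=> P Q Q0 PQ; apply: const0 Q0 _; move: PQ; rewrite /vderiv.
by under eq_bigr do rewrite /= Evf0; under [in RHS]eq_bigr do rewrite /= Evf0.
Qed.

(** * The chain rule *)

Section ChainRule.
Variables (U : fieldType) (d : U -> U) (derd : is_derivation d).
Variables (R : comNzRingType) (sigma : {rmorphism R -> U}) (delta : R -> R).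
Hypothesis dsigma : forall a, d (sigma a) = sigma (delta a).
Variables (n : nat) (t : 'I_n -> U).

Definition mcoefwise (G : {mpoly R[n]}) : {mpoly R[n]} :=
  \sum_(m <- msupp G) delta G@_m *: 'X_[m].

(** Both sides satisfy the Leibniz rule in the monomial, so that the variables
    suffice. *)
Lemma chain_monomial m :
  d (mmap sigma t 'X_[m]) = \sum_(i < n) mmap sigma t ('X_[m]^`M(i)) * d (t i).
Proof.
pose ok G := d (mmap sigma t G) = \sum_(i < n) mmap sigma t (G^`M(i)) * d (t i).
rewrite -/(ok _) mpolyXE_id.
have ok1 : ok 1.
  rewrite /ok rmorph1 derivation1 // big1 // => i _.
  by rewrite -mpolyC1 mderivC rmorph0 mul0r.
have okM G H : ok G -> ok H -> ok (G * H).
  rewrite /ok rmorphM derivationM // => -> ->; rewrite mulr_suml mulr_sumr -big_split.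
  by apply: eq_bigr => i _; rewrite /= mderivM rmorphD !rmorphM /=; ring.
have okX i : ok 'X_i.
  rewrite /ok mmapX mmap1U (bigD1 i) //= big1 ?addr0 => [|j ne_ji].
    rewrite mderivX mnm1E eqxx scale1r (_ : (U_(i) - U_(i))%MM = 0%MM) ?mpolyX0.
      by rewrite rmorph1 mul1r.
    by apply/mnmP=> l; rewrite mnmBE subnn mnm0E.
  by rewrite mderivX mnm1E eq_sym (negPf ne_ji) scale0r rmorph0 mul0r.
elim/big_ind: _ => // i _; elim: (m i) => [|k IH]; first by rewrite expr0.
by rewrite exprS; exact: okM.
Qed.

Lemma chain_rule G : d (mmap sigma t G) =
  mmap sigma t (mcoefwise G) + \sum_(i < n) mmap sigma t (G^`M(i)) * d (t i).
Proof.
rewrite [in LHS](mpolyE G) rmorph_sum derivation_sum // /mcoefwise rmorph_sum.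
have -> : \sum_(i < n) mmap sigma t G^`M(i) * d (t i) =
    \sum_(m <- msupp G) sigma G@_m * d (mmap sigma t 'X_[m]).
  under [RHS]eq_bigr => m _ do rewrite chain_monomial mulr_sumr.
  rewrite exchange_big; apply: eq_bigr => i _.
  rewrite [in LHS](mpolyE G) (raddf_sum (mderiv i)) (raddf_sum (mmap sigma t)) mulr_suml; apply: eq_bigr => m _ /=.
  by rewrite mderivZ mmapZ mulrA.
rewrite -big_split; apply: eq_bigr => m _.
by rewrite /= !mmapZ derivationM // dsigma.
Qed.

End ChainRule.

(** * The vector field of several copies of the equation *)

Section LienardField.
Variables (R : comNzRingType) (m : nat).

Definition var (i : nat) : {mpoly R[m.*2]} := if insub i is Some o then 'X_o else 0.

Definition at_var (p : {poly R}) i : {mpoly R[m.*2]} := (map_poly (@mpolyC m.*2 R) p).[var i].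

(** The variables [2 j] and [2 j + 1] stand for the [j]-th solution and its
    derivative; the field is multiplied by the product of all the [W(var (2 j))]
    to make it polynomial. *)
Definition lienard_field (W N1 N2 : {poly R}) (i : 'I_m.*2) : {mpoly R[m.*2]} :=
  if odd i then
    - (\prod_(j < m | j != i./2 :> nat) at_var W j.*2) *
      (var i * at_var N1 i.-1 + at_var N2 i.-1)
  else (\prod_(j < m) at_var W j.*2) * var i.+1.

End LienardField.

Arguments lienard_field [R] m W N1 N2 i.

Section LienardMap.
Variables (R S : comNzRingType) (rho : {rmorphism R -> S}) (m : nat).

Lemma map_var i : map_mpoly rho (var R m i) = var S m i.
Proof. by rewrite /var; case: insub => [o|]; rewrite ?rmorph0 // map_mpolyX. Qed.

Lemma map_at_var (p : {poly R}) i :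
  map_mpoly rho (at_var m p i) = at_var m (map_poly rho p) i.
Proof.
rewrite /at_var -[LHS]horner_map /= map_var -!map_poly_comp; congr (_.[_]).
by apply: eq_map_poly => a /=; rewrite map_mpolyC.
Qed.

Lemma map_lienard_field (W N1 N2 : {poly R}) i :
  map_mpoly rho (lienard_field m W N1 N2 i) =
  lienard_field m (map_poly rho W) (map_poly rho N1) (map_poly rho N2) i.
Proof.
rewrite /lienard_field; case: ifP => _.
  rewrite rmorphM rmorphN rmorphD rmorphM /= !map_at_var map_var rmorph_prod.
  by congr (- _ * _); apply: eq_bigr => j _ /=; rewrite map_at_var.
rewrite rmorphM /= map_var rmorph_prod; congr (_ * _).
by apply: eq_bigr => j _ /=; rewrite map_at_var.
Qed.

End LienardMap.

Section LienardEval.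
Variables (U : fieldType) (d : U -> U) (derd : is_derivation d).
Variables (R : comNzRingType) (sigma : {rmorphism R -> U}).
Hypothesis dsigma : forall a, d (sigma a) = 0.
Variables (m : nat) (z : nat -> U).
Let w (i : 'I_m.*2) := jets d z i.

Lemma mmap_var i : (i < m.*2)%N -> mmap sigma w (var R m i) = jets d z i.
Proof. by move=> lt_i; rewrite /var insubT mmapX mmap1U. Qed.

Lemma mmap_at_var p i : (i < m.*2)%N ->
  mmap sigma w (at_var m p i) = (map_poly sigma p).[jets d z i].
Proof.
move=> lt_i; rewrite /at_var -[LHS]horner_map /= mmap_var // -map_poly_comp.
by congr (_.[_]); apply: eq_map_poly => a /=; rewrite mmapC.
Qed.

Variables W N1 N2 : {poly R}.
Hypothesis ode : forall j, (map_poly sigma W).[z j] * d (d (z j)) +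
  d (z j) * (map_poly sigma N1).[z j] + (map_poly sigma N2).[z j] = 0.

Definition lienard_factor := \prod_(j < m) (map_poly sigma W).[z j].

Let jets_even j : jets d z j.*2 = z j.
Proof. by rewrite /jets odd_double doubleK. Qed.

Let jets_odd j : jets d z j.*2.+1 = d (z j).
Proof. by rewrite /jets /= odd_double /= uphalf_double. Qed.

Lemma mmap_lienard_field i :
  mmap sigma w (lienard_field m W N1 N2 i) = d (w i) * lienard_factor.
Proof.
have prodE (P : pred 'I_m) : mmap sigma w (\prod_(j < m | P j) at_var m W j.*2) =
    \prod_(j < m | P j) (map_poly sigma W).[z j].
  rewrite rmorph_prod; apply: eq_bigr => j _ /=.
  by rewrite mmap_at_var ?ltn_double // jets_even.
have := ltn_ord i; rewrite -{1}(odd_double_half i) /lienard_field.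
have Ei := odd_double_half i; case: ifP Ei => oi Ei lt_i.
  have lt_j : (i./2 < m)%N by rewrite -ltn_double; apply: leq_trans lt_i; rewrite add1n.
  have Ei1 : i.-1 = i./2.*2 by rewrite -{1}Ei.
  rewrite rmorphM rmorphN rmorphD rmorphM /= prodE Ei1 !mmap_at_var ?ltn_double // mmap_var //.
  have -> : w i = d (z i./2) by rewrite /w -{1}Ei jets_odd.
  have -> : jets d z i = d (z i./2) by rewrite -{1}Ei jets_odd.
  have -> : lienard_factor = (map_poly sigma W).[z i./2] *
      \prod_(j < m | j != i./2 :> nat) (map_poly sigma W).[z j].
    by rewrite /lienard_factor (bigD1 (Ordinal lt_j)).
  rewrite jets_even mulrA [d (d _) * _]mulrC.
  have /eqP := ode i./2; rewrite -addrA addr_eq0 => /eqP ->; ring.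
have lt_j : (i./2 < m)%N by rewrite -ltn_double; move: lt_i.
have Ei1 : i.+1 = i./2.*2.+1 by rewrite -{1}Ei.
have -> : w i = z i./2 by rewrite /w -{1}Ei jets_even.
rewrite rmorphM /= prodE Ei1 mmap_var; last by rewrite ltn_Sdouble.
by rewrite jets_odd mulrC.
Qed.

Lemma mmap_lienard_vderiv G :
  mmap sigma w (vderiv (lienard_field m W N1 N2) G) = d (mmap sigma w G) * lienard_factor.
Proof.
have d0 a : d (sigma a) = sigma ((fun _ => 0) a) by rewrite dsigma rmorph0.
rewrite (chain_rule derd d0) /mcoefwise big1 ?rmorph0 ?add0r; last by move=> l _; rewrite scale0r.
rewrite /vderiv rmorph_sum mulr_suml; apply: eq_bigr => i _.
by rewrite rmorphM /= mmap_lienard_field; ring.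
Qed.

End LienardEval.

(** * Constants of the fields generated by independent solutions *)

Fact clear_denominators (F : fieldType) (q s m u v : F) : m != 0 -> v != 0 ->
  (s / m + u / v) * q * (m * v) = q * (s * v + u * m).
Proof. by move=> m0 v0; field; rewrite m0 v0. Qed.

Lemma has_residue_horner (C U : fieldType) (iota : {rmorphism C -> U}) (P Q : {poly C}) c r :
  Q != 0 -> has_residue (P%:F / Q%:F) c r ->
  exists a u v : {poly C}, [/\ v.[c] != 0, r = a`_0 &
    forall z, (map_poly iota Q).[z] != 0 -> (map_poly iota v).[z] != 0 -> z != iota c ->
    (map_poly iota P).[z] / (map_poly iota Q).[z] =
    \sum_(i < size a) iota a`_i / (z - iota c) ^+ i.+1
    + (map_poly iota u).[z] / (map_poly iota v).[z]].
Proof.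
move=> Q0 [a [u [v [vc EPQ ->]]]]; exists a, u, v; split=> // z Qz vz zc.
have v0 : v != 0 by apply: contraNneq vc => ->; rewrite horner0.
pose X := 'X - c%:P; have X0 : X != 0 by rewrite polyXsubC_eq0.
pose S := \sum_(i < size a) (a`_i)%:P * X ^+ (size a - i.+1).
have tofrac_neq0 (p : {poly C}) : p != 0 -> p%:F != 0 by rewrite tofrac_eq0.
have EM i : (i < size a)%N -> X ^+ size a = X ^+ (size a - i.+1) * X ^+ i.+1.
  by move=> lt_i; rewrite -exprD subnK.
have ES : \sum_(i < size a) (a`_i)%:P%:F / (X ^+ i.+1)%:F = S%:F / (X ^+ size a)%:F.
  rewrite rmorph_sum mulr_suml; apply: eq_bigr => i _.
  rewrite (EM i (ltn_ord i)) !rmorphM /= invfM mulrA.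
  congr (_ / _); rewrite mulfK // tofrac_neq0 // expf_neq0 //.
have Epoly : P * (X ^+ size a * v) = Q * (S * v + u * X ^+ size a).
  apply/eqP; rewrite -tofrac_eq; apply/eqP; rewrite !rmorphM rmorphD !rmorphM /=.
  move: EPQ; rewrite ES => /(canRL (divfK (tofrac_neq0 _ Q0))) ->.
  exact: clear_denominators (tofrac_neq0 _ (expf_neq0 (size a) X0)) (tofrac_neq0 _ v0).
have zc0 : z - iota c != 0 by rewrite subr_eq0.
have HX : (map_poly iota X).[z] = z - iota c by rewrite rmorphB /= map_polyX map_polyC !hornerE.
have HS : (map_poly iota S).[z] = \sum_(i < size a) iota a`_i * (z - iota c) ^+ (size a - i.+1).
  rewrite rmorph_sum horner_sum; apply: eq_bigr => i _.
  by rewrite rmorphM rmorphXn /= map_polyC hornerM hornerC horner_exp HX.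
have HM p q : (map_poly iota (p * q)).[z] = (map_poly iota p).[z] * (map_poly iota q).[z].
  by rewrite rmorphM hornerM.
have HXn : (map_poly iota (X ^+ size a)).[z] = (z - iota c) ^+ size a.
  by rewrite rmorphXn /= horner_exp HX.
have := congr1 (fun p => (map_poly iota p).[z]) Epoly.
rewrite !HM rmorphD hornerD !HM HXn.
have -> : \sum_(i < size a) iota a`_i / (z - iota c) ^+ i.+1 =
    (map_poly iota S).[z] / (z - iota c) ^+ size a.
  rewrite HS mulr_suml; apply: eq_bigr => i _.
  have -> : (z - iota c) ^+ size a = (z - iota c) ^+ (size a - i.+1) * (z - iota c) ^+ i.+1.
    by rewrite -exprD subnK.
  by rewrite invfM mulrA mulfK ?expf_neq0.
have x0 := expf_neq0 (size a) zc0.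
rewrite -(clear_denominators _ _ _ x0 vz) => Exy.
apply: (mulIf Qz); rewrite divfK //.
by apply: (mulIf (mulf_neq0 x0 vz)).
Qed.

Section SolutionField.
Variables (U : fieldType) (d : U -> U) (derd : is_derivation d).

Lemma field_gen_diff (X : set U) : (forall x, X x -> field_gen X (d x)) ->
  is_diff_subfield d (field_gen X).
Proof.
move=> dX; have subX := field_gen_subfield X; split=> // x Xx.
suff /(_ x Xx) [] : field_gen X `<=` [set y | field_gen X y /\ field_gen X (d y)] by [].
apply: field_gen_min => [|y Xy]; last by split; [exact: sub_field_gen|exact: dX].
split=> [|y1 y2 [X1 dX1] [X2 dX2]|y1 y2 [X1 dX1] [X2 dX2]].
- by split; [exact: (subfield1 subX)|rewrite derivation1 //; exact: (subfield0 subX)].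
- by split; rewrite ?derivationB //; exact: (subfieldB subX).
- split; first exact: (subfield_div subX).
  have [->|y20] := eqVneq y2 0; first by rewrite invr0 mulr0 derivation0 //; exact: (subfield0 subX).
  rewrite derivation_div //; apply: (subfield_div subX); last exact: (subfieldX subX).
  by apply: (subfieldB subX); exact: (subfieldM subX).
Qed.

Lemma solution_second_der (L : set U) (W N1 N2 : {poly U}) z : is_subfield L ->
  (forall i, L W`_i) -> (forall i, L N1`_i) -> (forall i, L N2`_i) ->
  L z -> L (d z) -> W.[z] != 0 -> W.[z] * d (d z) + d z * N1.[z] + N2.[z] = 0 -> L (d (d z)).
Proof.
move=> subL LW LN1 LN2 Lz Ldz Wz ode.
have -> : d (d z) = - (d z * N1.[z] + N2.[z]) / W.[z].
  by move/eqP: ode; rewrite -addrA addr_eq0 => /eqP <-; rewrite mulrC mulKf.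
have Lp (p : {poly U}) : (forall i, L p`_i) -> L p.[z] by move=> Lp; exact: (subfield_horner subL).
apply: (subfield_div subL (subfieldN subL (subfieldD subL _ _))); [|exact: Lp|exact: Lp].
by apply: (subfieldM subL) => //; exact: Lp.
Qed.

Lemma solution_field_diff (F : set U) (W N1 N2 : {poly U}) z :
  is_diff_subfield d F -> (forall i, F W`_i) -> (forall i, F N1`_i) -> (forall i, F N2`_i) ->
  W.[z] != 0 -> W.[z] * d (d z) + d z * N1.[z] + N2.[z] = 0 ->
  is_diff_subfield d (field_gen (F `|` [set z; d z])).
Proof.
move=> [subF dF] FW FN1 FN2 Wz ode; apply: field_gen_diff.
set X := F `|` _; have FX x : F x -> field_gen X x by move=> Fx; apply: sub_field_gen; left.
have Xz : field_gen X z by apply: sub_field_gen; right; left.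
have Xdz : field_gen X (d z) by apply: sub_field_gen; right; right.
move=> x [Fx|[->|->]] //; first by apply: FX; exact: dF.
apply: (solution_second_der (field_gen_subfield X) _ _ _ Xz Xdz Wz ode) => i; exact: FX.
Qed.

Lemma independent_horner_neq0 (F : set U) (p : {poly U}) x y : is_subfield F ->
  alg_independent F (fun i : 'I_2 => pair_fun x y i) ->
  (forall i, F p`_i) -> p != 0 -> p.[x] != 0.
Proof.
move=> subF /(independent2P subF) [trx _] Fp p0; apply/eqP => px; apply: trx.
by exists p; split=> //; exact/rootP.
Qed.

End SolutionField.

Fact limit_equation_div (F : fieldType) (q b p x y : F) : q != 0 -> b != 0 ->
  q * b * y + x * (p * b) = 0 -> y = - (p / q) * x.
Proof.
move=> q0 b0 E; apply: (mulfI (mulf_neq0 q0 b0)).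
by move/eqP: E; rewrite addr_eq0 => /eqP ->; field.
Qed.

Section Constants.
Variables (U : fieldType) (d : U -> U) (dcfU : is_DCF0 d) (satU : saturated d).
Variables (C : fieldType) (iota : {rmorphism C -> U}).
Hypothesis constU : [set x | d x = 0] = range iota.

Lemma d_iota x : d (iota x) = 0.
Proof. by rewrite -[_ = 0]/([set x | d x = 0] _) constU; exists x. Qed.

Lemma constant_iota y : d y = 0 -> exists x, y = iota x.
Proof. by move=> dy; have : [set x | d x = 0] y by []; rewrite constU => -[x _ <-]; exists x. Qed.

Section LimitField.
Variables (m : nat) (P Q B : {poly C}) (c r : C).
Hypotheses (Q0 : Q != 0) (B0 : B != 0) (r0 : r != 0) (resPQ : has_residue (P%:F / Q%:F) c r).
Let field0 := lienard_field m (Q * B) (P * B) 0.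

(** The fraction [G / H] is evaluated at a tuple of solutions of the limit
    equation that is generic over the finitely many constants involved. Such a
    tuple is obtained by adding solutions one at a time, and by
    [limit_equation_constants] no step creates a constant. *)
Lemma limit_field_constants (G H : {mpoly C[m.*2]}) : H != 0 ->
  vderiv field0 G * H = G * vderiv field0 H -> exists a, G = a *: H.
Proof.
move=> H0 GH; have derd := DCF0_derivation dcfU; have char0 := DCF0_char0 dcfU.
have [a [u [v [vc Er res]]]] := has_residue_horner iota Q0 resPQ.
have v0 : v != 0 by apply: contraNneq vc => ->; rewrite horner0.
(* Finitely many parameters, so that saturation applies whatever the size of [C]. *)
pose s : seq C := c :: (Q * B : seq C) ++ (P * B : seq C) ++ (a : seq C) ++ (u : seq C) ++
  (v : seq C) ++ (Q : seq C) ++ [seq G@_l | l <- msupp G] ++ [seq H@_l | l <- msupp H].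
pose A := iota @` [set` s].
have sA : small A by apply: small_finite => //; apply: finite_image; exact: finite_seq.
have tA x : x \in s -> term_values d A (iota x).
  by move=> sx; apply: term_fun_param; exists x.
have tp (p : {poly C}) : {subset (p : seq C) <= s} -> forall i, term_values d A (map_poly iota p)`_i.
  move=> sp i; rewrite coef_map /=.
  have [lt_ip|le_pi] := ltnP i (size p); first by apply/tA/sp/mem_nth.
  by rewrite nth_default // rmorph0; exact: term_fun0.
have sQB : {subset (Q * B : seq C) <= s} by move=> x sx; rewrite inE !mem_cat sx !orbT.
have sPB : {subset (P * B : seq C) <= s} by move=> x sx; rewrite inE !mem_cat sx !orbT.
have sa : {subset (a : seq C) <= s} by move=> x sx; rewrite inE !mem_cat sx !orbT.
have su : {subset (u : seq C) <= s} by move=> x sx; rewrite inE !mem_cat sx !orbT.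
have sv : {subset (v : seq C) <= s} by move=> x sx; rewrite inE !mem_cat sx !orbT.
have sQ : {subset (Q : seq C) <= s} by move=> x sx; rewrite inE !mem_cat sx !orbT.
have sG : {subset [seq G@_l | l <- msupp G] <= s} by move=> x sx; rewrite inE !mem_cat sx !orbT.
have sH : {subset [seq H@_l | l <- msupp H] <= s} by move=> x sx; rewrite inE !mem_cat sx !orbT.
have QB0 : map_poly iota (Q * B) != 0 by rewrite map_poly_eq0 mulf_neq0.
have t0 i : term_values d A (map_poly iota 0)`_i by rewrite rmorph0 coef0; exact: term_fun0.
have [D [z gen]] := generic_sequence_exists dcfU satU sA (tp _ sQB) (tp _ sPB) t0 QB0.
have [D0 DS ode ind] := gen.
pose L j := diff_field_gen d (D j).
have dL j : is_diff_subfield d (L j) by exact: diff_field_gen_diff.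
have L0const : L 0 `<=` range iota.
  rewrite /L D0; apply: diff_field_gen_min; last by move=> _ [x _ <-]; exists x.
  by split; [exact: range_subfield|move=> _ [x _ <-]; rewrite d_iota; exists 0; rewrite ?rmorph0].
have Lc j x : x \in s -> L j (iota x).
  move=> sx; apply: (diff_field_gen_mono (generic_sequence_sub gen (leq0n j))).
  by rewrite D0; apply: sub_diff_field_gen; exists x.
have Lp j (p : {poly C}) : {subset (p : seq C) <= s} -> forall i, L j (map_poly iota p)`_i.
  move=> sp i; rewrite coef_map /=.
  have [lt_ip|le_pi] := ltnP i (size p); first by apply: Lc; apply: sp; exact: mem_nth.
  by rewrite nth_default // rmorph0; exact: subfield0 (dL j).1.
have Lt0 j i : L j (map_poly iota 0)`_i.
  by rewrite rmorph0 coef0; exact: subfield0 (dL j).1.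
have z_neq0 j (p : {poly C}) : {subset (p : seq C) <= s} -> p != 0 -> (map_poly iota p).[z j] != 0.
  move=> sp p0; apply: (independent_horner_neq0 (dL j).1 (ind j)); last by rewrite map_poly_eq0.
  exact: Lp.
have L_const j e : L j e -> d e = 0 -> L 0 e.
  elim: j => // j IH Le de; apply: IH => //.
  have zc : z j != iota c.
    apply/eqP => Ez; have [trz _] := (independent2P (dL j).1 _ _).1 (ind j).
    by apply: trz; rewrite Ez; apply: algebraic_over_id (dL j).1 _; apply: Lc; rewrite mem_head.
  apply: (@limit_equation_constants U d derd char0 (L j) (dL j) (z j) (ind j) (iota c)
    (map_poly iota a) (map_poly iota u) (map_poly iota v)) => //.
  - by apply: Lc; rewrite mem_head.
  - exact: d_iota.
  - exact: Lp.
  - exact: Lp.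
  - exact: Lp.
  - by rewrite coef_map /= fmorph_eq0 -Er.
  - by rewrite horner_map fmorph_eq0.
  - have BQz := z_neq0 j _ sQB (mulf_neq0 Q0 B0).
    rewrite size_map_poly.
    rewrite (eq_bigr (fun i : 'I__ => iota a`_i / (z j - iota c) ^+ i.+1)) => [|i _].
      2: by rewrite coef_map.
    rewrite -res ?z_neq0 //; have := ode j; rewrite rmorph0 horner0 addr0.
    move: BQz; rewrite !rmorphM /= !hornerM mulf_eq0 negb_or => /andP[Qz Bz].
    exact: limit_equation_div.
  - have Ldiff := solution_field_diff derd (dL j) (Lp j _ sQB) (Lp j _ sPB) (Lt0 j)
      (z_neq0 j _ sQB (mulf_neq0 Q0 B0)) (ode j).
    apply: (diff_field_gen_min Ldiff) Le => y; rewrite DS => -[Dy|->].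
      by apply: sub_field_gen; left; exact: sub_diff_field_gen.
    by apply: sub_field_gen; right; left.
have subL0 := (dL 0).1.
pose w i := jets d z i.
have indw : alg_independent (L 0) (fun i : 'I_m.*2 => w i).
  by apply: (generic_sequence_independent gen) => //; rewrite /L D0.
have ev_neq0 (G' : {mpoly C[m.*2]}) : (forall l, L 0 (iota G'@_l)) ->
    mmap iota (fun i : 'I_m.*2 => w i) G' = 0 -> G' = 0.
  move=> LG; rewrite mmap_map_mpoly => G'0.
  have E0 : map_mpoly iota G' = 0 by apply: indw => // l; rewrite mcoeff_map_mpoly; exact: LG.
  by apply/mpolyP=> l; apply: (fmorph_inj iota); rewrite -mcoeff_map_mpoly E0 !mcoeff0 rmorph0.
have LGH (G' : {mpoly C[m.*2]}) : {subset [seq G'@_l | l <- msupp G'] <= s} -> forall l, L 0 (iota G'@_l).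
  move=> sG' l; have [lG|/memN_msupp_eq0 ->] := boolP (l \in msupp G').
    by apply: Lc; apply: sG'; exact: map_f.
  by rewrite rmorph0; exact: subfield0 subL0.
set evw := mmap iota (fun i : 'I_m.*2 => w i).
have Hw : evw H != 0 by apply: contraNneq H0 => /ev_neq0 -> //; exact: LGH.
have factor0 : lienard_factor iota m z (Q * B) != 0.
  by apply/prodf_neq0 => j _; apply: z_neq0 => //; exact: mulf_neq0.
have dconst : d (evw G / evw H) = 0.
  apply/(derivation_div_eq0 derd _ Hw); apply: (mulIf factor0).
  have := congr1 evw GH; rewrite /evw !rmorphM /= !(mmap_lienard_vderiv derd d_iota ode) => E.
  by rewrite mulrAC E mulrA.
have Ljets i : (i < m.*2)%N -> L m (w i).
  move=> lt_i; have lt_im : (i./2 < m)%N.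
    by rewrite -ltn_double; apply: leq_ltn_trans lt_i; rewrite -{2}(odd_double_half i) leq_addl.
  have Lz : L m (z i./2) by apply: sub_diff_field_gen; exact: (generic_sequence_mem gen lt_im).
  by rewrite /w /jets; case: (odd i) => //=; exact: (dL m).2.
have Lev (G' : {mpoly C[m.*2]}) : (forall l, L 0 (iota G'@_l)) -> L m (evw G').
  move=> LG'; rewrite /evw mmap_map_mpoly; apply: (subfield_meval (dL m).1) => [l|i]; last exact: Ljets.
  rewrite mcoeff_map_mpoly; apply: (diff_field_gen_mono (generic_sequence_sub gen (leq0n m))).
  exact: LG'.
have L0Egh : L 0 (evw G / evw H).
  apply: (L_const m) => //.
  by apply: (subfield_div (dL m).1); apply: Lev; exact: LGH.
have [a' _ Ea'] : range iota (evw G / evw H).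
  exact: L0const.
exists a'; apply/eqP; rewrite -subr_eq0; apply/eqP/ev_neq0.
  move=> l; rewrite mcoeffB mcoeffZ rmorphB rmorphM; apply: (subfieldB subL0); first exact: LGH.
  apply: (subfieldM subL0); last exact: LGH.
  by rewrite Ea'.
by rewrite rmorphB /= mmapZ Ea' divfK // subrr.
Qed.

End LimitField.
End Constants.

Lemma mmap_comp (R S T : comNzRingType) (h : {rmorphism R -> S}) (tau : {rmorphism S -> T}) n
    (s : 'I_n -> S) (G : {mpoly R[n]}) :
  tau (mmap h s G) = mmap (tau \o h) (tau \o s) G.
Proof.
rewrite rmorph_sum; apply: eq_bigr => l _; rewrite rmorphM rmorph_prod /=.
by congr (_ * _); apply: eq_bigr => i _; rewrite rmorphXn.
Qed.

Section GenericConstants.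
Variables (U : fieldType) (d : U -> U) (dcfU : is_DCF0 d) (satU : saturated d).
Variables (C : fieldType) (iota : {rmorphism C -> U}).
Hypothesis constU : [set x | d x = 0] = range iota.
Variables (k : fieldType) (h : {rmorphism k -> C}) (p : nat) (A B : {poly {mpoly k[p]}}).
Variables (P Q : {poly k}) (c r : C).
Hypotheses (Q0 : Q != 0) (r0 : r != 0)
  (resPQ : has_residue ((map_poly h P)%:F / (map_poly h Q)%:F) c r).
Variable s0 : 'I_p -> k.
Hypotheses (B0 : specialize idfun s0 B != 0) (A0 : specialize idfun s0 A = 0).
Variable s : 'I_p -> C.
Hypothesis gens : alg_independent (range h) s.

Definition family_lead : {poly {mpoly k[p]}} := map_poly (@mpolyC p k) Q * B.
Definition family_damping : {poly {mpoly k[p]}} := map_poly (@mpolyC p k) P * B.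
Definition family_force : {poly {mpoly k[p]}} := A * map_poly (@mpolyC p k) Q.

Variable param_eval : {rmorphism {mpoly k[p]} -> U}.
Hypothesis param_evalE : forall a, param_eval a = iota (mmap h s a).

Let K := field_gen (range (iota \o h) `|` range (iota \o s)).

Lemma param_eval_in a : K (param_eval a).
Proof.
have subK : is_subfield K by exact: field_gen_subfield.
rewrite param_evalE mmap_comp; apply: (subfield_sum subK) => l _.
apply: (subfieldM subK); first by apply: sub_field_gen; left; exists a@_l.
apply: (subfield_prod subK) => i _; apply: (subfieldX subK).
by apply: sub_field_gen; right; exists i.
Qed.

Lemma param_eval_eq0 a : param_eval a = 0 -> a = 0.
Proof.
move/eqP; rewrite param_evalE fmorph_eq0 => /eqP a0.
exact: (alg_independentP h s).1 gens a a0.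
Qed.

Variables (m : nat) (z : nat -> U).
Hypothesis ode : forall j, (map_poly param_eval family_lead).[z j] * d (d (z j)) +
  d (z j) * (map_poly param_eval family_damping).[z j] + (map_poly param_eval family_force).[z j] = 0.
Let w (i : 'I_m.*2) := jets d z i.
Hypothesis indw : alg_independent K w.
Hypothesis lead0 : forall j, (map_poly param_eval family_lead).[z j] != 0.

Let vf := lienard_field m family_lead family_damping family_force.

(** The line through [s0], reached at [0], and [s], reached at [1]. *)
Lemma segment_exists : exists seg : {rmorphism {mpoly k[p]} -> {poly C}},
  forall a, (seg a).[0] = h (mmap idfun s0 a) /\ (seg a).[1] = mmap h s a.
Proof.
exists (mmap (polyC \o h) (fun i => (h (s0 i))%:P + (s i - h (s0 i)) *: 'X)) => a.
have E x : horner_eval x \o (polyC \o h) =1 h by move=> y /=; rewrite horner_evalE hornerC.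
have Eseg x : (mmap (polyC \o h) (fun i => (h (s0 i))%:P + (s i - h (s0 i)) *: 'X) a).[x] =
    mmap h (fun i => h (s0 i) + (s i - h (s0 i)) * x) a.
  rewrite -[LHS]/(horner_eval x _) mmap_comp /mmap; apply: eq_bigr => l _; rewrite E.
  congr (_ * _); apply: eq_bigr => i _ /=.
  by rewrite horner_evalE !(hornerD, hornerC, hornerZ, hornerX).
rewrite !Eseg mmap_comp; split; apply: eq_bigr => l _; congr (_ * _); apply: eq_bigr => i _ /=.
  by rewrite mulr0 addr0.
by rewrite mulr1 addrC subrK.
Qed.

(** A constant fraction over [k[S]] restricts to the line; at [s0] the force
    vanishes and constants are trivial by [limit_field_constants], hence
    [constants_specialization] makes the fraction trivial at [s]. *)
Lemma family_identity (G H : {mpoly {mpoly k[p]}[m.*2]}) :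
  vderiv vf G * H = G * vderiv vf H ->
  forall l l', param_eval G@_l * param_eval H@_l' = param_eval G@_l' * param_eval H@_l.
Proof.
have [seg segP] := segment_exists.
have field_at0 i : map_mpoly (horner_eval 0) (map_mpoly seg (vf i)) =
    lienard_field m (map_poly h Q * map_poly h (specialize idfun s0 B))
                    (map_poly h P * map_poly h (specialize idfun s0 B)) 0 i.
  have E (q : {poly {mpoly k[p]}}) :
      map_poly (horner_eval 0) (map_poly seg q) = map_poly h (specialize idfun s0 q).
    rewrite /specialize -!map_poly_comp; apply: eq_map_poly => a /=.
    by rewrite horner_evalE (segP _).1.
  have EC (q : {poly k}) : specialize idfun s0 (map_poly (@mpolyC p k) q) = q.
    by rewrite /specialize -map_poly_comp map_poly_id // => a _ /=; rewrite mmapC.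
  have EM q q' : specialize idfun s0 (q * q') = specialize idfun s0 q * specialize idfun s0 q'.
    by rewrite /specialize rmorphM.
  by rewrite /vf !map_lienard_field !E !EM !EC A0 mul0r rmorph0 !rmorphM.
move=> GH l l'.
have hQ0 : map_poly h Q != 0 by rewrite map_poly_eq0.
have hB0 : map_poly h (specialize idfun s0 B) != 0 by rewrite map_poly_eq0.
have const0 := limit_field_constants dcfU satU constU hQ0 hB0 r0 resPQ.
have E := constants_specialization field_at0 (const0 m) GH l l'.
rewrite !param_evalE -!(rmorphM iota) -!(segP _).2 -!hornerM; congr (iota _.[1]).
exact: E.
Qed.

(** A constant of the field generated by independent solutions gives a relation
    over [k(s)] between polynomials, which is an identity over [k[S]] because
    [s] is generic. *)
Lemma generic_field_constants e : field_gen (K `|` range w) e -> d e = 0 -> K e.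
Proof.
move=> Le de; have derd := DCF0_derivation dcfU.
have dsig a : d (param_eval a) = 0 by rewrite param_evalE (d_iota constU).
have [ev evE] : exists ev : {rmorphism {mpoly {mpoly k[p]}[m.*2]} -> U},
    forall G, ev G = mmap param_eval w G by exists (mmap param_eval w).
have evM : {morph ev : x y / x * y} by exact: rmorphM.
have evB : {morph ev : x y / x - y} by exact: rmorphB.
have evD G : ev (vderiv vf G) = d (ev G) * lienard_factor param_eval m z family_lead.
  by rewrite !evE; exact: (mmap_lienard_vderiv derd dsig ode G).
have {Le} : field_gen (range (iota \o h) `|` range (iota \o s) `|` range w) e.
  apply: field_gen_min Le; first exact: field_gen_subfield.
  move=> y [Ky|wy]; last by apply: sub_field_gen; right.
  by apply: field_gen_mono Ky => x Xx; left.
have evC a : ev a%:MP = param_eval a by rewrite evE mmapC.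
move/(field_gen_range (phi := ev)) => -[|G [H [H0 Ee]]].
  move=> _ [[[a _ <-]|[i _ <-]]|[i _ <-]].
  - by exists (a%:MP)%:MP => //; rewrite evC param_evalE mmapC.
  - by exists ('X_i)%:MP => //; rewrite evC param_evalE mmapX mmap1U.
  - by exists 'X_i => //; rewrite evE mmapX mmap1U.
have factor0 : lienard_factor param_eval m z family_lead != 0.
  by apply/prodf_neq0 => j _; exact: lead0.
have GH : vderiv vf G * H = G * vderiv vf H.
  move: (evD G) (evD H); move: (vderiv vf G) (vderiv vf H) => DG DH EDG EDH.
  have : ev (DG * H - G * DH) = 0.
    have /(derivation_div_eq0 derd _ H0) E : d (ev G / ev H) = 0 by rewrite -Ee.
    rewrite evB !evM EDG EDH.
    by rewrite mulrA -E mulrAC subrr.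
  rewrite evE mmap_map_mpoly => ev0.
  apply/eqP; rewrite -subr_eq0; apply/eqP/mpolyP => l; rewrite mcoeff0.
  apply: param_eval_eq0; rewrite -mcoeff_map_mpoly (indw _ ev0) ?mcoeff0 // => l'.
  by rewrite mcoeff_map_mpoly; exact: param_eval_in.
have [l' Hl'] : exists l', param_eval H@_l' != 0.
  apply: contrapT => nH; case/eqP: H0; rewrite evE /mmap big1 // => l _.
  have [->|Hl] := eqVneq (param_eval H@_l) 0; first by rewrite mul0r.
  by case: nH; exists l.
have -> : e = param_eval G@_l' / param_eval H@_l'.
  apply: (mulIf H0); rewrite Ee divfK //; apply: (mulIf Hl'); rewrite mulrAC divfK //.
  rewrite mulrC -!evC -!evM !evE !mmap_map_mpoly; congr (_.@[_]).
  apply/mpolyP => l; rewrite !mcoeff_map_mpoly.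
  have EZ a (G' : {mpoly {mpoly k[p]}[m.*2]}) : param_eval (a%:MP * G')@_l = param_eval a * param_eval G'@_l.
    by rewrite mcoeffCM; exact: rmorphM.
  transitivity (param_eval H@_l' * param_eval G@_l); first exact: EZ.
  by rewrite mulrC (family_identity GH); apply/esym; exact: EZ.
exact: (subfield_div (field_gen_subfield _) (param_eval_in _) (param_eval_in _)).
Qed.

End GenericConstants.

(** * Linear disjointness from the constants *)

Section LinearDisjointness.
Variables (U : fieldType) (d : U -> U) (derd : is_derivation d).
Variables (K L : set U) (subK : is_subfield K) (dL : is_diff_subfield d L).
Hypotheses (dK : forall x, K x -> d x = 0) (KL : K `<=` L).
Hypothesis constL : forall x, L x -> d x = 0 -> K x.

(** Divided by [e n], the relation has the constant [c n] as its last term, and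
    differentiating it removes that term. A relation over [K] between the
    derivatives of the [e i / e n] integrates back, the integration constant
    being in [L] and hence in [K]. *)
Lemma constant_relation n (e c : nat -> U) :
  (forall i, L (e i)) -> (forall i, d (c i) = 0) -> \sum_(i < n) c i * e i = 0 ->
  (exists2 i, (i < n)%N & c i != 0) ->
  exists b : nat -> U, [/\ forall i, K (b i), exists2 i, (i < n)%N & b i != 0 &
    \sum_(i < n) b i * e i = 0].
Proof.
have subL := dL.1; elim: n e c => [|n IH] e c Le dc rel [i0 lt_i0 ci0] //.
have [en0|en0] := eqVneq (e n) 0.
  exists (fun i => (i == n)%:R); split=> [i||].
  - by case: eqP => _; [exact: subfield1|exact: subfield0].
  - by exists n; rewrite ?eqxx ?oner_neq0.
  - rewrite big_ord_recr /= eqxx mul1r en0 addr0 big1 // => i _.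
    by rewrite ltn_eqF // mul0r.
have {i0 lt_i0 ci0} ex_c : exists2 i, (i < n)%N & c i != 0.
  apply: contrapT => nc; have c0 i : (i < n)%N -> c i = 0.
    by move=> lt_in; apply/eqP; apply: contraT => ci; case: nc; exists i.
  have cn : c n != 0.
    by move: lt_i0; rewrite ltnS leq_eqVlt => /predU1P[<-//|/c0 E]; rewrite E eqxx in ci0.
  move: rel; rewrite big_ord_recr /= big1 => [/eqP|i _]; last by rewrite c0 ?mul0r.
  by rewrite add0r mulf_eq0 (negPf cn) (negPf en0).
pose e' i := e i / e n.
have Le' i : L (e' i) by exact: (subfield_div subL).
have d_sum (b : nat -> U) : (forall i, d (b i) = 0) ->
    d (\sum_(i < n) b i * e' i) = \sum_(i < n) b i * d (e' i).
  by move=> db; rewrite derivation_sum //; apply: eq_bigr => i _; rewrite derivationM // db mul0r add0r.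
have sumE (b : nat -> U) : \sum_(i < n) b i * e' i = (\sum_(i < n) b i * e i) / e n.
  by rewrite mulr_suml; apply: eq_bigr => i _; rewrite mulrA.
have [||b [Kb [i1 lt_i1 bi1] relb]] := IH (fun i => d (e' i)) c _ dc _ ex_c.
- by move=> i; apply: dL.2; exact: Le'.
- rewrite -d_sum // sumE; move: rel; rewrite big_ord_recr /= => /eqP.
  by rewrite addr_eq0 => /eqP ->; rewrite mulNr mulfK // derivationN // dc oppr0.
have Kkappa : K (\sum_(i < n) b i * e' i).
  apply: constL; last by rewrite d_sum // => i; exact: dK.
  by apply: (subfield_sum subL) => i _; apply: (subfieldM subL) => //; exact: KL.
exists (fun i => if (i < n)%N then b i else - \sum_(i < n) b i * e' i); split=> [i||].
- by case: ifP => // _; exact: subfieldN.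
- by exists i1; [exact: ltnW|rewrite lt_i1].
rewrite big_ord_recr /= ltnn sumE mulNr divfK // (eq_bigr (fun i : 'I_n => b i * e i)) ?subrr //.
by move=> i _; rewrite ltn_ord.
Qed.

Lemma independent_over_constants (C : fieldType) (iota : {rmorphism C -> U}) n (t : 'I_n -> U) :
  (forall x, d (iota x) = 0) -> (forall i, L (t i)) -> alg_independent K t ->
  forall G : {mpoly C[n]}, mmap iota t G = 0 -> G = 0.
Proof.
move=> diota Lt ind G G0; have subL := dL.1; apply/eqP; apply: contraT => Gn0; exfalso.
pose mon i := nth 0%MM (msupp G) i; pose N := size (msupp G).
have sumN (F : 'X_{1..n} -> U) : \sum_(l <- msupp G) F l = \sum_(i < N) F (mon i).
  by rewrite (big_nth 0%MM) big_mkord.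
have [|||b [Kb [i0 lt_i0 bi0] rel]] := constant_relation (n := N) (e := fun i => mmap1 t (mon i))
    (c := fun i => iota G@_(mon i)) _ (fun i => diota _).
- move=> i; apply: (subfield_prod subL) => j _; exact: (subfieldX subL).
- by rewrite -[RHS]G0 /mmap sumN.
- have NG : (0 < N)%N by rewrite lt0n size_eq0 msupp_eq0.
  by exists 0; rewrite // fmorph_eq0 -mcoeff_msupp mem_nth.
pose H : {mpoly U[n]} := \sum_(i < N) b i *: 'X_[mon i].
have EH i : (i < N)%N -> H@_(mon i) = b i.
  move=> lt_iN; rewrite /H raddf_sum (bigD1 (Ordinal lt_iN)) //= mcoeffZ mcoeffX eqxx mulr1.
  rewrite big1 ?addr0 // => j ne_ji; rewrite mcoeffZ mcoeffX nth_uniq ?msupp_uniq //.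
  by rewrite -val_eqE /= in ne_ji; rewrite (negPf ne_ji) mulr0.
move: bi0; rewrite -EH // (ind H) ?mcoeff0 ?eqxx // => [l|].
  rewrite /H raddf_sum; apply: (subfield_sum subK) => i _ /=; rewrite mcoeffZ mcoeffX.
  by apply: (subfieldM subK) => //; case: eqP => _; [exact: subfield1|exact: subfield0].
rewrite -[RHS]rel /H raddf_sum; apply: eq_bigr => i _ /=.
by rewrite mevalZ mevalX.
Qed.

End LinearDisjointness.

(** * Eliminating the coefficients of a first integral *)

Section Elimination.
Variables (U C : fieldType) (iota : {rmorphism C -> U}) (d : U -> U).
Hypothesis charC : [pchar C] =i pred0.
Variables (D : nat) (z : nat -> U).
Let N := (D * D)%N.

(** The monomials of bidegree less than [D], numbered by [i < D * D] in such a way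
    that [x = y], [u = y ^ D] turns the [i]-th one into [y ^ i]. *)
Definition bimonomial (A : comNzRingType) (x u : A) (i : nat) : A := x ^+ (i %% D) * u ^+ (i %/ D).

Variables (al be : 'I_N -> U) (c : 'I_(N + N) -> C).
Hypothesis indep : forall G : {mpoly C[(N + N).*2]},
  mmap iota (fun i : 'I_(N + N).*2 => jets d z i) G = 0 -> G = 0.
Hypothesis rel : forall j : 'I_(N + N),
  iota (c j) * (\sum_i be i * bimonomial (z j) (d (z j)) i) =
  \sum_i al i * bimonomial (z j) (d (z j)) i.
Hypothesis be0 : exists i, be i != 0.
Hypothesis c_neq : forall i : 'I_N, c (lshift N i) != c (rshift N i).

Definition relation_mx (A : comNzRingType) (f : C -> A) (x u : nat -> A) : 'M[A]_(N + N) :=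
  \matrix_(i, j) match fintype.split i with
    | inl i => f (c j) * bimonomial (x j) (u j) i
    | inr i => bimonomial (x j) (u j) i
    end.

(** The coefficients of a fraction [al / be] whose values at the points [z j]
    are constants [c j] are solutions of a linear system with entries in
    [C(z)]. Its determinant therefore vanishes, and since the [z j] are
    independent over [C], it vanishes identically; but it does not at the points
    [(i, i ^ D)], where the monomials become the powers of [i]. *)
Lemma constant_values_dependent : False.
Proof.
pose X j := var C (N + N) j.*2; pose Y j := var C (N + N) j.*2.+1.
pose V := relation_mx (@mpolyC (N + N).*2 C) X Y.
pose ev := mmap iota (fun i : 'I_(N + N).*2 => jets d z i).
have evV : map_mx ev V = relation_mx iota z (d \o z).
  have evX (j : 'I_(N + N)) : ev (X j) = z j.
    by rewrite /ev mmap_var ?ltn_double // /jets odd_double doubleK.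
  have evY (j : 'I_(N + N)) : ev (Y j) = d (z j).
    by rewrite /ev mmap_var ?ltn_Sdouble // /jets /= odd_double /= uphalf_double.
  have evB (j : 'I_(N + N)) i : ev (bimonomial (X j) (Y j) i) = bimonomial (z j) (d (z j)) i.
    by rewrite /bimonomial /ev rmorphM !rmorphXn /= -/ev evX evY.
  apply/matrixP=> i j; rewrite !mxE; case: (fintype.split i) => i' /=; last exact: evB.
  have evM : {morph ev : G H / G * H} by exact: rmorphM.
  by rewrite evM evB [ev _]mmapC.
have detV : \det V = 0.
  apply: indep; rewrite -/ev -[LHS]/(ev _) -[LHS](det_map_mx ev) evV.
  apply/eqP/det0P; exists (row_mx (\row_i be i) (- \row_i al i)).
    have [i0 bi0] := be0; apply: contraNneq bi0 => /(congr1 lsubmx).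
    by rewrite row_mxKl => /rowP/(_ i0); rewrite !mxE => ->.
  apply/rowP=> j; rewrite !mxE big_split_ord /=.
  apply/eqP; rewrite addr_eq0 -sumrN; apply/eqP.
  transitivity (iota (c j) * (\sum_i be i * bimonomial (z j) (d (z j)) i)).
    rewrite mulr_sumr; apply: eq_bigr => i _.
    by rewrite row_mxEl !mxE (unsplitK (inl _ i)) mulrCA.
  rewrite rel; apply: eq_bigr => i _.
  by rewrite row_mxEr !mxE (unsplitK (inr _ i)) mulNr opprK.
(* The points [lshift i] and [rshift i] both go to [(i, i ^ D)], so that only the
   values of [c] distinguish their columns. *)
pose th (j : 'I_(N + N)) : C := match fintype.split j with inl i => i%:R | inr i => i%:R end.
pose pt (i : 'I_(N + N).*2) : C := oapp (fun j => if odd i then th j ^+ D else th j) 0 (insub i./2).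
have ptX (j : 'I_(N + N)) : (X j).@[pt] = th j.
  rewrite /X /var insubT ?ltn_double // => lt_j; rewrite mevalXU /pt /= odd_double doubleK.
  by rewrite valK.
have ptY (j : 'I_(N + N)) : (Y j).@[pt] = th j ^+ D.
  rewrite /Y /var insubT ?ltn_Sdouble // => lt_j; rewrite mevalXU /pt /= odd_double /=.
  by rewrite uphalf_double valK.
have ptB (j : 'I_(N + N)) i : (bimonomial (X j) (Y j) i).@[pt] = th j ^+ i.
  rewrite /bimonomial mevalM !rmorphXn /= ptX ptY -exprM -exprD.
  by congr (_ ^+ _); rewrite [RHS](divn_eq i D) addnC mulnC.
have : \det (map_mx (meval pt) V) = 0 by rewrite det_map_mx detV rmorph0.
move/eqP/det0P => [v v0 vV].
pose p := rVpoly (lsubmx v); pose q := rVpoly (rsubmx v).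
have hornerE (v' : 'rV[C]_N) x : (rVpoly v').[x] = \sum_i v' 0 i * x ^+ i.
  rewrite (horner_coef_wide _ (size_poly _ _)); apply: eq_bigr => i _.
  by rewrite coef_rVpoly_ord.
have pq (j : 'I_(N + N)) : c j * p.[th j] + q.[th j] = 0.
  have /rowP/(_ j) := vV; rewrite !mxE big_split_ord /= => E; rewrite -[RHS]E.
  rewrite /p /q !hornerE mulr_sumr; congr (_ + _); apply: eq_bigr => i _; rewrite !mxE.
    by rewrite (unsplitK (inl _ i)) mevalM mevalC ptB mulrCA.
  by rewrite (unsplitK (inr _ i)) ptB.
have th_l i : th (lshift N i) = i%:R by rewrite /th (unsplitK (inl _ i)).
have th_r i : th (rshift N i) = i%:R by rewrite /th (unsplitK (inr _ i)).
have rV_eq0 (v' : 'rV[C]_N) : (forall i : 'I_N, (rVpoly v').[i%:R] = 0) -> v' = 0.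
  move=> roots; rewrite -[v']rVpolyK; suff -> : rVpoly v' = 0 by rewrite linear0.
  apply/eqP; apply: contraT => p0.
  have : (size [seq i%:R : C | i <- seq.iota 0 N] < size (rVpoly v'))%N.
    apply: max_poly_roots => //; last by rewrite map_inj_uniq ?iota_uniq //; exact: nat_inj.
    rewrite all_map; apply/allP => i; rewrite mem_iota add0n => lt_iN /=.
    by rewrite rootE (roots (Ordinal lt_iN)).
  by rewrite size_map size_iota ltnNge size_poly.
have p0 : lsubmx v = 0.
  apply: rV_eq0 => i; have := pq (lshift N i); have := pq (rshift N i).
  rewrite th_l th_r => /eqP; rewrite addr_eq0 => /eqP Er /eqP; rewrite addr_eq0 -Er.
  by rewrite -subr_eq0 -mulrBl mulf_eq0 subr_eq0 (negPf (c_neq i)) => /eqP.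
have q0 : rsubmx v = 0.
  apply: rV_eq0 => i; have := pq (lshift N i).
  by rewrite th_l /p p0 raddf0 horner0 mulr0 add0r.
by case/eqP: v0; rewrite -[v]hsubmxK p0 q0 row_mx0.
Qed.

End Elimination.

(** * Constants over arbitrary differential fields *)

Section Bimonomials.
Variables (R S : comNzRingType) (phi : {rmorphism R -> S}) (D : nat).

Definition mnm2 (i : nat) : 'X_{1..2} := [multinom nth 0%N [:: i %% D; i %/ D]%N j | j < 2].

Lemma mnm2K (l : 'X_{1..2}) : (mdeg l < D)%N ->
  (l ord0 + l ord_max * D < D * D)%N /\ mnm2 (l ord0 + l ord_max * D) = l.
Proof.
rewrite mdegE !big_ord_recl big_ord0 addn0 => lt_lD.
have -> : l ord_max = l (lift ord0 ord0) by congr (l _); apply/val_inj.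
have lt0 : (l ord0 < D)%N by apply: leq_ltn_trans lt_lD; exact: leq_addr.
have lt1 : (l (lift ord0 ord0) < D)%N by apply: leq_ltn_trans lt_lD; exact: leq_addl.
split.
  apply: leq_trans (_ : (l (lift ord0 ord0)).+1 * D <= _)%N; last by rewrite leq_mul2r lt1 orbT.
  by rewrite mulSn ltn_add2r.
apply/mnmP => -[[|[|//]] lt_j]; rewrite mnmE /= ?(addnC (l ord0)).
  by rewrite modnMDl modn_small //; congr (l _); apply/val_inj.
by rewrite divnMDl ?(leq_ltn_trans _ lt0) // divn_small // addn0; congr (l _); apply/val_inj.
Qed.

Lemma mmap_bimonomial (x : 'I_2 -> S) (G : {mpoly R[2]}) : (msize G <= D)%N ->
  mmap phi x G = \sum_(i < D * D) phi G@_(mnm2 i) * bimonomial D (x ord0) (x ord_max) i.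
Proof.
move=> le_GD.
have E1 (i : nat) : bimonomial D (x ord0) (x ord_max) i = mmap1 x (mnm2 i).
  rewrite /bimonomial /mmap1 !big_ord_recl big_ord0 mulr1 !mnmE /=.
  by congr (_ * x _ ^+ _); apply/val_inj.
pose idx (l : 'X_{1..2}) := (l ord0 + l ord_max * D)%N.
have mn_inj : {in seq.iota 0 (D * D) &, injective mnm2}.
  move=> i i'; rewrite !mem_iota !add0n => lt_i lt_i' /mnmP E.
  have := E ord0; have := E ord_max; rewrite !mnmE /= => E1' E0'.
  by rewrite (divn_eq i D) (divn_eq i' D) E0' E1'.
transitivity (\sum_(l <- [seq mnm2 i | i <- seq.iota 0 (D * D)]) phi G@_l * mmap1 x l); last first.
  rewrite big_map (_ : seq.iota 0 (D * D) = index_iota 0 (D * D)) ?big_mkord.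
    by apply: eq_bigr => i _; rewrite E1.
  by rewrite /index_iota subn0.
rewrite [RHS](bigID (mem (msupp G))) /= [X in _ + X]big1 => [|l /memN_msupp_eq0 ->]; last first.
  by rewrite rmorph0 mul0r.
rewrite addr0 -big_filter; apply: perm_big; apply: uniq_perm; first exact: msupp_uniq.
  by rewrite filter_uniq // map_inj_in_uniq ?iota_uniq.
move=> l; rewrite mem_filter /=; have [lG|//] := boolP (l \in msupp G).
have [lt_l El] := mnm2K (leq_trans (msize_mdeg_lt lG) le_GD).
by apply/esym/mapP; exists (idx l); rewrite ?mem_iota ?add0n.
Qed.

End Bimonomials.

Section FirstOrder.
Variables (U : fieldType) (d : U -> U) (derd : is_derivation d).
Variables (F : fieldType) (phi : {rmorphism F -> U}) (delta : F -> F).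
Hypothesis dphi : forall x, d (phi x) = phi (delta x).
Variables W N1 N2 : {poly F}.

Definition jet2 (x : U) : 'I_2 -> U := fun i => pair_fun x (d x) i.

Definition at_ord0 (q : {poly F}) : {mpoly F[2]} := (map_poly (@mpolyC 2 F) q).['X_ord0].

Lemma mmap_at_ord0 (q : {poly F}) x : mmap phi (jet2 x) (at_ord0 q) = (map_poly phi q).[x].
Proof.
rewrite /at_ord0 -[LHS]horner_map /= mmapX mmap1U -map_poly_comp.
by congr (_.[_]); apply: eq_map_poly => y /=; rewrite mmapC.
Qed.

(** [W] times the derivation that the equation induces on [F[x, x']]. *)
Definition equation_der (G : {mpoly F[2]}) : {mpoly F[2]} :=
  at_ord0 W * (mcoefwise delta G + 'X_ord_max * G^`M(ord0))
  - ('X_ord_max * at_ord0 N1 + at_ord0 N2) * G^`M(ord_max).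

Lemma mmap_equation_der x G :
  (map_poly phi W).[x] * d (d x) + d x * (map_poly phi N1).[x] + (map_poly phi N2).[x] = 0 ->
  mmap phi (jet2 x) (equation_der G) = (map_poly phi W).[x] * d (mmap phi (jet2 x) G).
Proof.
move=> ode; rewrite (chain_rule derd dphi) !big_ord_recl big_ord0 addr0.
have -> : lift ord0 ord0 = ord_max :> 'I_2 by apply/val_inj.
set ev := mmap phi (jet2 x).
have evM : {morph ev : A B / A * B} by exact: rmorphM.
have evD : {morph ev : A B / A + B} by exact: rmorphD.
have evB : {morph ev : A B / A - B} by exact: rmorphB.
have evX : ev 'X_ord_max = d x by rewrite /ev mmapX mmap1U.
have evA q : ev (at_ord0 q) = (map_poly phi q).[x] by exact: mmap_at_ord0.
rewrite /equation_der evB !(evM, evD) evX !evA /jet2 /=.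
move: (ev (mcoefwise _ _)) (ev G^`M(ord0)) (ev G^`M(ord_max)) => u v w.
move/eqP: ode; rewrite -addrA addr_eq0 => /eqP ode.
transitivity ((map_poly phi W).[x] * (u + v * d x) + w * ((map_poly phi W).[x] * d (d x))).
  by rewrite ode; ring.
ring.
Qed.

End FirstOrder.

Section Core.
Variables (U : fieldType) (d : U -> U) (dcfU : is_DCF0 d) (satU : saturated d).
Variables (C : fieldType) (iota : {rmorphism C -> U}).
Hypothesis constU : [set x | d x = 0] = range iota.
Variables (K : set U) (W N1 N2 : {poly U}).
Hypotheses (subK : is_subfield K) (constK : forall x, K x -> d x = 0).
Hypotheses (KW : forall i, K W`_i) (KN1 : forall i, K N1`_i) (KN2 : forall i, K N2`_i).
Hypothesis W0 : W != 0.
Local Notation solution x := (W.[x] * d (d x) + d x * N1.[x] + N2.[x] = 0).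

Hypothesis no_new_constants : forall m z, (forall j, solution (z j)) -> (forall j, W.[z j] != 0) ->
  alg_independent K (fun i : 'I_m.*2 => jets d z i) ->
  forall e, field_gen (K `|` range (fun i : 'I_m.*2 => jets d z i)) e -> d e = 0 -> K e.

Let derd := DCF0_derivation dcfU.

Lemma solutions_independent_over_constants m (z : nat -> U) :
  (forall j, solution (z j)) -> (forall j, W.[z j] != 0) ->
  alg_independent K (fun i : 'I_m.*2 => jets d z i) ->
  forall G : {mpoly C[m.*2]}, mmap iota (fun i : 'I_m.*2 => jets d z i) G = 0 -> G = 0.
Proof.
move=> sol Wz ind; pose w (i : 'I_m.*2) := jets d z i.
pose X := K `|` range w; have subX := field_gen_subfield X.
have Xjet i : (i < m.*2)%N -> field_gen X (jets d z i).
  by move=> lt_i; apply: sub_field_gen; right; exists (Ordinal lt_i).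
have dX : is_diff_subfield d (field_gen X).
  apply: (field_gen_diff derd) => x [/constK ->|[i _ <-]]; first exact: (subfield0 subX).
  have Ei := odd_double_half i; have lt_i := ltn_ord i.
  rewrite /w /jets; case: (boolP (odd i)) Ei => oi Ei /=.
    have Xdz : field_gen X (d (z i./2)).
      by have := Xjet _ lt_i; rewrite /jets oi.
    have Xz : field_gen X (z i./2).
      have lt_i' : (i./2.*2 < m.*2)%N by apply: leq_trans lt_i; rewrite -{2}Ei add1n.
      by have := Xjet _ lt_i'; rewrite /jets odd_double doubleK.
    have FX x' : K x' -> field_gen X x' by move=> Kx; apply: sub_field_gen; left.
    apply: (solution_second_der subX _ _ _ Xz Xdz (Wz _) (sol _)) => l; exact: FX.
  have lt_i' : (i.+1 < m.*2)%N by move: lt_i; rewrite -{1 2}Ei add0n ltn_double ltn_Sdouble.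
  by have := Xjet _ lt_i'; rewrite /jets /= oi /= uphalf_half (negPf oi).
apply: (independent_over_constants derd subK dX constK _ _ (d_iota constU)) => //.
- by move=> x Kx; apply: sub_field_gen; left.
- exact: (no_new_constants sol Wz ind).
- by move=> i; exact: Xjet.
Qed.

(** A constant of [F(a, a')] is the value at [(a, a')] of a fraction [G / H] over
    [F]. That it is constant is an identity over [F] because [a] is generic, so
    the values of [G / H] at successive generic solutions are constants too.
    They are distinct unless the fraction is a scalar, and
    [constant_values_dependent] applies to them. *)
Lemma generic_solution_constants (F : set U) (a e : U) :
  is_diff_subfield d F -> K `<=` F -> small F -> solution a ->
  alg_independent F (fun i : 'I_2 => pair_fun a (d a) i) ->
  diff_field_gen d (F `|` [set a]) e -> d e = 0 -> F e.
Proof.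
move=> dF KF sF sol_a ind_a Fe de; have [subF derF] := dF.
have [FT [phi EF]] := subfield_typeP subF.
have Fphi x : F (phi x) by rewrite EF; exists x.
have liftF x : F x -> exists y, phi y = x by rewrite EF => -[y _ <-]; exists y.
have /choice [delta Edelta] : forall x, exists y, phi y = d (phi x).
  by move=> x; apply: liftF; exact: derF.
have lift_polyF (q : {poly U}) : (forall i, K q`_i) -> exists q', map_poly phi q' = q.
  by move=> Kq; apply: lift_poly => i; rewrite -EF; exact: KF.
have [W' EW] := lift_polyF _ KW; have [N1' EN1] := lift_polyF _ KN1; have [N2' EN2] := lift_polyF _ KN2.
have dphi x : d (phi x) = phi (delta x) by rewrite Edelta.
have Wneq0 (L : set U) x : is_subfield L -> F `<=` L ->
    alg_independent L (fun i : 'I_2 => pair_fun x (d x) i) -> W.[x] != 0.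
  by move=> subL FL ind; apply: (independent_horner_neq0 subL ind) => // i; exact/FL/KF.
have Wa : W.[a] != 0 by exact: Wneq0 ind_a.
pose jet x : 'I_2 -> U := jet2 d x.
pose tot := equation_der delta W' N1' N2'.
have totE x G : solution x -> mmap phi (jet x) (tot G) = W.[x] * d (mmap phi (jet x) G).
  by rewrite -EW -EN1 -EN2; exact: mmap_equation_der.
have [G [H [Ha Ee]]] : exists G H, mmap phi (jet a) H != 0 /\
    e = mmap phi (jet a) G / mmap phi (jet a) H.
  apply: adjoinP; rewrite -EF.
  have FX (q : {poly U}) : (forall l, K q`_l) -> forall l, F q`_l by move=> Kq l; exact: KF.
  have Fdiff := solution_field_diff derd dF (FX _ KW) (FX _ KN1) (FX _ KN2) Wa sol_a.
  have : field_gen (F `|` [set a; d a]) e.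
    apply: (diff_field_gen_min Fdiff) Fe => x [Fx|->]; apply: sub_field_gen; [by left|by right; left].
  apply: field_gen_mono => x [Fx|[->|->]]; [by left|right|right].
    by exists ord0.
  by exists ord_max.
have ev_eq0 (L : set U) x (T : {mpoly FT[2]}) : F `<=` L ->
    alg_independent L (fun i : 'I_2 => pair_fun x (d x) i) -> mmap phi (jet x) T = 0 -> T = 0.
  move=> FL ind; rewrite mmap_map_mpoly => T0.
  have E0 : map_mpoly phi T = 0 by apply: ind => // l; rewrite mcoeff_map_mpoly; exact/FL/Fphi.
  by apply/mpolyP=> l; apply: (fmorph_inj phi); rewrite -mcoeff_map_mpoly E0 !mcoeff0 rmorph0.
have H0 : H != 0 by apply: contraNneq Ha => ->; rewrite rmorph0.
have GH : tot G * H = G * tot H.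
  apply/eqP; rewrite -subr_eq0; apply/eqP/(ev_eq0 F a) => //.
  have evM : {morph mmap phi (jet a) : A B / A * B} by exact: rmorphM.
  have evB : {morph mmap phi (jet a) : A B / A - B} by exact: rmorphB.
  rewrite evB !evM !totE // -mulrA [in X in _ - X]mulrCA -mulrBr.
  have /(derivation_div_eq0 derd _ Ha) -> : d (mmap phi (jet a) G / mmap phi (jet a) H) = 0.
    by rewrite -Ee.
  by rewrite subrr mulr0.
apply: contrapT => nFe.
have tF (q : {poly U}) : (forall i, K q`_i) -> forall i, term_values d F q`_i.
  by move=> Kq i; apply: term_fun_param; exact: KF.
have [B [z gen]] := generic_sequence_exists dcfU satU sF (tF _ KW) (tF _ KN1) (tF _ KN2) W0.
have [B0 BS sol ind] := gen.
pose L j := diff_field_gen d (B j).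
have dL j : is_diff_subfield d (L j) by exact: diff_field_gen_diff.
have FL j : F `<=` L j.
  move=> x Fx; apply: sub_diff_field_gen; apply: (generic_sequence_sub gen (leq0n j)).
  by rewrite B0.
have Lphi j x : L j (phi x) by apply: FL; exact: Fphi.
have Wz j : W.[z j] != 0 by exact: (Wneq0 _ _ (dL j).1 (FL j) (ind j)).
pose ev j T := mmap phi (jet (z j)) T.
have Hz j : ev j H != 0.
  by apply: contraNneq H0 => /(ev_eq0 _ _ _ (FL j) (ind j)) ->.
have evM j : {morph ev j : A A' / A * A'} by exact: rmorphM.
have /choice [c Ec] : forall j, exists y, iota y = ev j G / ev j H.
  move=> j; have [y ->] : exists y, ev j G / ev j H = iota y; last by exists y.
  apply: (constant_iota constU); apply/(derivation_div_eq0 derd _ (Hz j)).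
  apply: (mulfI (Wz j)); have := congr1 (ev j) GH.
  by rewrite !evM /ev !totE // => E; rewrite mulrA E mulrCA.
have cG j : iota (c j) * ev j H = ev j G by rewrite Ec divfK.
have Ljets j l : (j < l)%N -> forall T, L l (ev j T).
  move=> lt_jl T; have Lz : L l (z j) by apply: sub_diff_field_gen; exact: (generic_sequence_mem gen).
  rewrite /ev mmap_map_mpoly; apply: (subfield_meval (dL l).1) => [i|[[|[|//]] lt_i]] /=.
  - by rewrite mcoeff_map_mpoly; exact: Lphi.
  - exact: Lz.
  - exact: (dL l).2.
(* [c j] belongs to the field over which [z l] is generic, so that equality would make
   [G - c j * H] vanish identically. *)
have c_inj j l : (j < l)%N -> c j != c l.
  move=> lt_jl; apply/eqP => Ecjl.
  have Lc : L l (iota (c j)).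
    by rewrite Ec; apply: (subfield_div (dL l).1); exact: Ljets.
  have Eq0 : map_mpoly phi G - iota (c j) *: map_mpoly phi H = 0.
    apply: (ind l) => [i|].
      rewrite mcoeffB mcoeffZ !mcoeff_map_mpoly; apply: (subfieldB (dL l).1); first exact: Lphi.
      by apply: (subfieldM (dL l).1) => //; exact: Lphi.
    rewrite mevalB mevalZ Ecjl -!mmap_map_mpoly; apply/eqP; rewrite subr_eq0 eq_sym; apply/eqP.
    exact: cG.
  have [i Hi] : exists i, H@_i != 0.
    apply: contrapT => nH; case/eqP: H0; apply/mpolyP => i; rewrite mcoeff0.
    by apply/eqP; apply: contraT => Hi; case: nH; exists i.
  apply: nFe; have coefG l' : phi G@_l' = iota (c j) * phi H@_l'.
    have := congr1 (mcoeff l') Eq0; rewrite mcoeffB mcoeffZ !mcoeff_map_mpoly mcoeff0.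
    by move/eqP; rewrite subr_eq0 => /eqP.
  have -> : e = phi (G@_i / H@_i).
    have Eio : iota (c j) = phi (G@_i / H@_i).
      by rewrite fmorph_div coefG mulfK // fmorph_eq0.
    rewrite Ee; apply: (mulIf Ha); rewrite divfK // -Eio !mmap_map_mpoly -mevalZ; congr (_.@[_]).
    by apply/mpolyP => l'; rewrite mcoeffZ !mcoeff_map_mpoly; exact: coefG.
  exact: Fphi.
pose D := (msize G + msize H)%N.
apply: (@constant_values_dependent U C iota d _ D z
  (fun i => phi G@_(mnm2 D i)) (fun i => phi H@_(mnm2 D i)) (fun j => c j)).
- by move=> r; rewrite -(fmorph_pchar iota) (DCF0_char0 dcfU).
- apply: solutions_independent_over_constants => //.
  apply: (generic_sequence_independent gen subK) => x /KF Fx; exact: sub_diff_field_gen.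
- move=> j; have := cG j; rewrite /ev.
  by rewrite (@mmap_bimonomial _ _ phi D _ H) ?leq_addl // (@mmap_bimonomial _ _ phi D _ G) ?leq_addr.
- have [i Hi] : exists i, i \in msupp H.
    by move: H0; rewrite -msupp_eq0; case: (msupp H) => // i s; exists i; rewrite mem_head.
  have [lt_i Ei] := mnm2K (leq_trans (msize_mdeg_lt Hi) (leq_addl (msize G) _)).
  by exists (Ordinal lt_i); rewrite /= Ei fmorph_eq0 -mcoeff_msupp.
- by move=> i; apply: c_inj => /=; apply: leq_trans (ltn_ord i) (leq_addr _ _).
Qed.

End Core.

(** * Orthogonality to the constants *)

Lemma tp_term_fun (U : fieldType) (d : U -> U) (K : set U) (y a : U) (h : U -> U) :
  realizes d (tp d K y) a -> term_fun d K h -> h y = 0 <-> h a = 0.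
Proof.
move=> real [t Kt Et]; split=> [hy|ha].
  by have := real (DEq t (DZero U unit)); rewrite /= Et; apply; split=> //=; rewrite Et.
apply: contrapT => hy; have := real (DNot (DEq t (DZero U unit))); rewrite /= Et; apply => //.
by split=> //=; rewrite Et.
Qed.

Lemma realizes_independent (U : fieldType) (d : U -> U) (K : set U) (y a : U) :
  realizes d (tp d K y) a ->
  alg_independent K (fun i : 'I_2 => pair_fun y (d y) i) ->
  alg_independent K (fun i : 'I_2 => pair_fun a (d a) i).
Proof.
move=> real ind G KG Ga; apply: ind => //.
have tG : term_fun d K (fun x => G.@[fun i => iter i d x]).
  by apply: term_fun_mpoly => m; exact: term_fun_param.
have jetE x : (fun i : 'I_2 => iter i d x) = (fun i : 'I_2 => pair_fun x (d x) i).
  by apply: funext => -[[|[|//]] lt_i].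
by have /= := (tp_term_fun real tG).2; rewrite !jetE; apply.
Qed.

Fact clear_equation (F : fieldType) (q b p a y' y'' : F) : q != 0 -> b != 0 ->
  y'' + y' * (p / q) + a / b = 0 -> q * b * y'' + y' * (p * b) + a * q = 0.
Proof.
move=> q0 b0 E; transitivity (q * b * (y'' + y' * (p / q) + a / b)); last by rewrite E mulr0.
by field; rewrite q0 b0.
Qed.

Theorem corollary4p17
  (* the saturated model of DCF_0, with field of constants C = R[i] *)
  (R : realType) (U : fieldType) (d : U -> U)
  (dcfU : is_DCF0 d) (satU : saturated d)
  (iota : {rmorphism R[i] -> U}) (constU : [set x | d x = 0] = range iota)
  (* the countable subfield k of C *)
  (k : fieldType) (j : {rmorphism k -> R[i]}) (countk : countable [set: k])
  (* g = A / B in k(S)(z), with S the affine space of dimension p *)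
  (p : nat) (A B : {poly {mpoly k[p]}})
  (* f = P / Q in k(z) *)
  (P Q : {poly k}) (Q_neq0 : Q != 0)
  (resf : exists c r : R[i],
     r != 0 /\ has_residue ((map_poly j P)%:F / (map_poly j Q)%:F) c r)
  (hs0 : exists s0 : 'I_p -> k,
     specialize idfun s0 B != 0 /\ specialize idfun s0 A = 0)
  (s : 'I_p -> R[i]) (gens : alg_independent (range j) s) :
  let K := field_gen (range (iota \o j) `|` range (iota \o s)) in
  let f y := (map_poly (iota \o j) P).[y] / (map_poly (iota \o j) Q).[y] in
  let g y := (specialize (iota \o j) (iota \o s) A).[y]
             / (specialize (iota \o j) (iota \o s) B).[y] in
  forall q : set (dformula U unit),
    is_generic_type d K f g q -> orthogonal_to_constants d K q.
Proof.
move=> K f g q [y [ode_y tr_y] ->] F dF KF sF a real disj e Fe de.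
have derd := DCF0_derivation dcfU; have subK : is_subfield K by exact: field_gen_subfield.
have Kconst x : K x -> d x = 0.
  move=> Kx; suff : range iota x by move=> [x' _ <-]; exact: d_iota.
  by apply: (field_gen_min (range_subfield iota)) Kx => _ [[x' _ <-]|[i _ <-]];
    [exists (j x')|exists (s i)].
have [c [r [r0 res]]] := resf; have [s0 [B0 A0]] := hs0.
have [ev evE] : exists ev : {rmorphism {mpoly k[p]} -> U}, forall x, ev x = iota (mmap j s x).
  by exists (iota \o mmap j s).
have ev_inj x : ev x = 0 -> x = 0 := param_eval_eq0 gens evE (a := x).
have ev_spec (T : {poly {mpoly k[p]}}) :
    map_poly ev T = specialize (iota \o j) (iota \o s) T.
  by apply: eq_map_poly => x; rewrite evE mmap_comp.
have ev_const (T : {poly k}) : map_poly ev (map_poly (@mpolyC p k) T) = map_poly (iota \o j) T.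
  by rewrite -map_poly_comp; apply: eq_map_poly => x /=; rewrite evE mmapC.
have evM (S T : {poly {mpoly k[p]}}) : map_poly ev (S * T) = map_poly ev S * map_poly ev T.
  exact: rmorphM.
pose W := map_poly ev (family_lead B Q).
pose N1 := map_poly ev (family_damping B P).
pose N2 := map_poly ev (family_force A Q).
have EW x : W.[x] = (map_poly (iota \o j) Q).[x] * (specialize (iota \o j) (iota \o s) B).[x].
  by rewrite /W /family_lead evM hornerM ev_const ev_spec.
have EN1 x : N1.[x] = (map_poly (iota \o j) P).[x] * (specialize (iota \o j) (iota \o s) B).[x].
  by rewrite /N1 /family_damping evM hornerM ev_const ev_spec.
have EN2 x : N2.[x] = (specialize (iota \o j) (iota \o s) A).[x] * (map_poly (iota \o j) Q).[x].
  by rewrite /N2 /family_force evM hornerM ev_const ev_spec.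
have Kev (T : {poly {mpoly k[p]}}) i : K (map_poly ev T)`_i.
  by rewrite coef_map; exact: (param_eval_in evE).
have W0 : W != 0.
  have B_neq0 : B != 0 by apply: contraNneq B0 => ->; rewrite /specialize rmorph0.
  have lead_neq0 : family_lead B Q != 0.
    rewrite mulf_neq0 // map_poly_eq0_id0 ?mpolyC_eq0 ?lead_coef_eq0 //.
  apply: contraNneq lead_neq0 => EW0; apply/eqP/polyP => i; rewrite coef0; apply: ev_inj.
  by rewrite -coef_map -/W EW0 coef0.
have ind_y := trdeg2_independent subK tr_y.
have Wy : W.[y] != 0 by apply: (independent_horner_neq0 subK ind_y) => //; exact: Kev.
have sol_y : W.[y] * d (d y) + d y * N1.[y] + N2.[y] = 0.
  move: Wy ode_y; rewrite /f /g EW EN1 EN2 mulf_eq0 negb_or => /andP[].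
  exact: clear_equation.
have ind_a := realizes_independent real ind_y.
have sol_a : W.[a] * d (d a) + d a * N1.[a] + N2.[a] = 0.
  have tK (T : {poly {mpoly k[p]}}) : term_fun d K (fun x => (map_poly ev T).[x]).
    by apply: term_fun_horner; [move=> i; apply: term_fun_param; exact: Kev|exact: term_fun_id].
  have td : term_fun d K d := term_fun_der (term_fun_id d K).
  apply: (tp_term_fun real (h := fun x => W.[x] * d (d x) + d x * N1.[x] + N2.[x]) _).1 sol_y.
  apply: term_funD (tK _); apply: term_funD; apply: term_funM => //; try exact: tK.
  exact: term_fun_der.
apply: (algebraic_over_id dF.1).
apply: (generic_solution_constants dcfU satU constU subK _ _ _ _ W0 _ dF KF sF sol_a) Fe de.
- exact: Kconst.
- exact: Kev.
- exact: Kev.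
- exact: Kev.
- move=> m z sol Wz indz e' Le' de'.
  exact: (generic_field_constants dcfU satU constU Q_neq0 r0 res B0 A0 gens evE sol indz Wz Le' de').
- apply: disj ind_a => i; have [_ dKa] := diff_field_gen_diff d (K `|` [set a]).
  have Ka : diff_field_gen d (K `|` [set a]) a by apply: sub_diff_field_gen; right.
  by case: i => -[|[|//]] lt_i /=; [exact: Ka|exact: dKa].
Qed.
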